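(* Let $M=N_T\times_fN_\theta$ be a warped product semi-slant submanifold of a nearly Kaehler manifold $\bar M$, where $N_T$ is a holomorphic submanifold and $N_\theta$ is a proper slant submanifold of $\bar M$ with slant angle $\theta$. Let $2\beta$ be the dimension of $N_\theta$. Then: (i) The squared norm of the second fundamental form $h$ of $M$ in $\bar M$ satisfies $$\|h\|^2\ \geq\ 4\beta\Big\{\csc^2\theta+\frac19\cot^2\theta\Big\}\|\mathrm{grad}\ln f\|^2,$$ where $\mathrm{grad}\ln f$ is the gradient of $\ln f$. (ii) If equality holds in the inequality of (i), then $N_T$ is totally geodesic in $\bar M$ and $N_\theta$ is a totally umbilical submanifold of $\bar M$. Moreover, $M$ is a minimal submanifold of $\bar M$.
   Context: An almost Hermitian manifold $(\bar M,J,g)$ is a manifold with an almost complex structure $J$ ($J^2=-I$) and a Riemannian metric $g$ with $g(JX,JY)=g(X,Y)$. It is nearly Kaehler if $(\bar\nabla_XJ)X=0$ for all vector fields $X$ on $\bar M$, where $\bar\nabla$ is the Levi-Civita connection of $g$. Warped product: given Riemannian manifolds $(N_1,g_1)$, $(N_2,g_2)$ and a positive differentiable function $f$ on $N_1$, $N_1\times_fN_2$ is $N_1\times N_2$ with the metric $g_1+f^2g_2$; $f$ is the warping function, a function on the first factor. A warped product semi-slant submanifold $N_T\times_fN_\theta$ of $\bar M$ is a submanifold which, with the induced metric, is a warped product of a holomorphic submanifold $N_T$ and a proper slant submanifold $N_\theta$ of $\bar M$. A submanifold $N$ of $\bar M$ is holomorphic if $J(T_pN)=T_pN$ for all $p\in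 N$, and totally real if $J(T_pN)\subseteq T_p^\perp N$ for all $p\in N$. It is slant with slant angle $\theta$ if for every $p\in N$ and every nonzero $X\in T_pN$ the angle between $JX$ and $T_pN$ equals the constant $\theta$; it is proper slant if it is slant and neither holomorphic nor totally real (i.e. $0<\theta<\pi/2$). The second fundamental form $h$ of a submanifold $M$ with induced connection $\nabla$ is given by $\bar\nabla_XY=\nabla_XY+h(X,Y)$. With a local orthonormal frame $\{e_1,\dots,e_n\}$ of $TM$, $\|h\|^2=\sum_{i,j=1}^n g(h(e_i,e_j),h(e_i,e_j))$, and the mean curvature vector is $H=\frac1n\sum_{i=1}^n h(e_i,e_i)$. A submanifold is totally geodesic if $h=0$, totally umbilical if $h(X,Y)=g(X,Y)H$ for all tangent $X,Y$, and minimal if $H=0$. The gradient of a function $\varphi$ on $M$ is defined by $g(\mathrm{grad}\,\varphi,X)=X\varphi$ for all tangent $X$. *)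

(* Defs.v *)
From mathcomp Require Import all_boot all_order all_algebra.
From mathcomp Require Import all_classical all_reals all_analysis.

Set Implicit Arguments.
Unset Strict Implicit.
Unset Printing Implicit Defensive.

Import Order.TTheory GRing.Theory Num.Theory.
Import numFieldNormedType.Exports.
Local Open Scope classical_set_scope.
Local Open Scope ring_scope.

(** Conventions.  Vectors are row vectors, so a linear map with matrix [A]
    acts by [v |-> v *m A].  A tensor field on a manifold is the family of its
    component functions in all charts, subject to the tensor transformation law.
    A tangent vector at a point is given by its components in a chart around
    that point.  A pointwise notion (an inequality between scalars, a property
    of tangent spaces) is required in every choice of charts around the points
    involved; all those used here are independent of this choice. *)

(** * Smooth functions on open sets of R^n *)

Fixpoint Ck (R : realType) (n : nat) (W : normedModType R) (k : nat)
    (U : set 'rV[R]_n) (F : 'rV[R]_n -> W) : Prop :=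
  match k with
  | 0%N => forall u, U u -> {for u, continuous F}
  | k'.+1 => (forall u, U u -> differentiable F u) /\
      forall i : 'I_n, Ck k' U (fun u => 'D_(delta_mx 0 i : 'rV[R]_n) F u)
  end.

Definition smooth_on (R : realType) (n : nat) (W : normedModType R)
    (U : set 'rV[R]_n) (F : 'rV[R]_n -> W) : Prop :=
  forall k, Ck k U F.

(** * Manifolds *)

(** [crd i] is the chart with domain [dom i], and [par i] is its inverse; their
    values outside [dom i] and [crd i @` dom i] are irrelevant. *)
Record charted (R : realType) (n : nat) := Charted {
  pt :> topologicalType;
  idx : Type;
  dom : idx -> set pt;
  crd : idx -> pt -> 'rV[R]_n;
  par : idx -> 'rV[R]_n -> pt }.

Arguments dom {R n} M i : rename.
Arguments crd {R n} M i : rename.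
Arguments par {R n} M i : rename.

Definition chart_image (R : realType) (n : nat) (M : charted R n) (i : idx M) :
  set 'rV[R]_n := crd M i @` dom M i.

Definition overlap (R : realType) (n : nat) (M : charted R n) (i j : idx M) :
  set 'rV[R]_n := crd M i @` (dom M i `&` dom M j).

Definition transition (R : realType) (n : nat) (M : charted R n) (i j : idx M) :
  'rV[R]_n -> 'rV[R]_n := crd M j \o par M i.

Record is_manifold (R : realType) (n : nat) (M : charted R n) : Prop := {
  manifold_hausdorff : hausdorff_space M;
  manifold_second_countable : @second_countable M;
  dom_cover : forall p : M, exists i, dom M i p;
  dom_open : forall i, open (dom M i);
  chart_image_open : forall i : idx M, open (chart_image i);
  crdK : forall i p, dom M i p -> par M i (crd M i p) = p;
  crd_continuous : forall i p, dom M i p -> {for p, continuous (crd M i)};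
  par_continuous : forall (i : idx M) u, chart_image i u -> {for u, continuous (par M i)};
  transition_smooth : forall i j : idx M, smooth_on (overlap i j) (transition i j) }.

Record manifold (R : realType) (n : nat) := Manifold {
  manifold_charted :> charted R n;
  manifoldP : is_manifold manifold_charted }.

Definition prod_charted (R : realType) (a b : nat)
    (M : charted R a) (N : charted R b) : charted R (a + b) :=
  @Charted R (a + b) (M * N)%type (idx M * idx N)%type
    (fun i => dom M i.1 `*` dom N i.2)
    (fun i p => row_mx (crd M i.1 p.1) (crd N i.2 p.2))
    (fun i u => (par M i.1 (lsubmx u), par N i.2 (rsubmx u))).

(** * Linear algebra of a scalar product with Gram matrix [G] *)

Section ScalarProduct.
Variables (R : realType) (m : nat) (G : 'M[R]_m).

Definition dotg (v w : 'rV[R]_m) : R := (v *m G *m w^T) 0 0.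

Definition normg (v : 'rV[R]_m) : R := Num.sqrt (dotg v v).

(** Orthogonal projection onto the row space of the row-free matrix [A], and
    onto its orthogonal complement. *)
Definition tangential n (A : 'M[R]_(n, m)) (v : 'rV[R]_m) : 'rV[R]_m :=
  v *m G *m A^T *m invmx (A *m G *m A^T) *m A.

Definition normal n (A : 'M[R]_(n, m)) (v : 'rV[R]_m) : 'rV[R]_m :=
  v - tangential A v.

(** The angle, in [0, pi/2], between a nonzero vector and the row space of [A]. *)
Definition angle_with n (A : 'M[R]_(n, m)) (v : 'rV[R]_m) : R :=
  acos (normg (tangential A v) / normg v).

(** A chosen orthonormal basis (its vectors are the rows); one exists as soon
    as [G] is symmetric and positive definite. *)
Definition onframe : 'M[R]_m := xget 0 [set E | E *m G *m E^T = 1%:M].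

End ScalarProduct.

(** * Tensor fields and the Levi-Civita connection *)

Definition tensor2 (R : realType) (n : nat) (M : charted R n) : Type :=
  idx M -> 'rV[R]_n -> 'M[R]_n.

Record is_riemannian (R : realType) (n : nat) (M : charted R n)
    (g : tensor2 M) : Prop := {
  metric_smooth : forall i : idx M, smooth_on (chart_image i) (g i);
  metric_sym : forall (i : idx M) u, chart_image i u -> (g i u)^T = g i u;
  metric_pos : forall (i : idx M) u, chart_image i u ->
    forall v, v != 0 -> 0 < dotg (g i u) v v;
  metric_transf : forall (i j : idx M) u, overlap i j u ->
    let D := jacobian (transition i j) u in
    g i u = D *m g j (transition i j u) *m D^T }.

Record is_almost_complex (R : realType) (n : nat) (M : charted R n)
    (J : tensor2 M) : Prop := {
  acs_smooth : forall i : idx M, smooth_on (chart_image i) (J i);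
  acs_square : forall (i : idx M) u, chart_image i u -> J i u *m J i u = - 1%:M;
  acs_transf : forall (i j : idx M) u, overlap i j u ->
    let D := jacobian (transition i j) u in
    J i u *m D = D *m J j (transition i j u) }.

Record is_almost_hermitian (R : realType) (n : nat) (M : charted R n)
    (J g : tensor2 M) : Prop := {
  ah_complex : is_almost_complex J;
  ah_riemannian : is_riemannian g;
  ah_compatible : forall (i : idx M) u, chart_image i u -> forall v w : 'rV[R]_n,
    dotg (g i u) (v *m J i u) (w *m J i u) = dotg (g i u) v w }.

Section Connection.
Variables (R : realType) (m : nat).
(* The components of the metric in a fixed chart. *)
Variable G : 'rV[R]_m -> 'M[R]_m.

Definition dmetric (u : 'rV[R]_m) (k i j : 'I_m) : R :=
  'D_(delta_mx 0 k : 'rV[R]_m) (fun u' => G u' i j) u.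

(** The Christoffel symbol Gamma^k_ij of the Levi-Civita connection. *)
Definition christoffel (u : 'rV[R]_m) (k i j : 'I_m) : R :=
  2^-1 * \sum_(l < m) invmx (G u) k l *
    (dmetric u i j l + dmetric u j i l - dmetric u l i j).

Definition christoffel_form (u v w : 'rV[R]_m) : 'rV[R]_m :=
  \row_k \sum_(i < m) \sum_(j < m) christoffel u k i j * v 0 i * w 0 j.

Definition nabla (X Y : 'rV[R]_m -> 'rV[R]_m) (u : 'rV[R]_m) : 'rV[R]_m :=
  'D_(X u) Y u + christoffel_form u (X u) (Y u).

(** Covariant derivative in the direction [v] of a vector field [V] along the
    map [psi] (pullback of the Levi-Civita connection). *)
Definition nabla_along n (psi V : 'rV[R]_n -> 'rV[R]_m) (u v : 'rV[R]_n) :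
    'rV[R]_m :=
  'D_v V u + christoffel_form (psi u) (v *m jacobian psi u) (V u).

End Connection.

(** (nabla_X J) X = nabla_X (J X) - J (nabla_X X).  The condition is local, so
    [X] ranges over the smooth vector fields on chart domains, which are given
    by arbitrary smooth component functions. *)
Definition is_nearly_kaehler (R : realType) (n : nat) (M : charted R n)
    (J g : tensor2 M) : Prop :=
  is_almost_hermitian J g /\
  forall (i : idx M) (X : 'rV[R]_n -> 'rV[R]_n), smooth_on (chart_image i) X ->
  forall u, chart_image i u ->
    nabla (g i) X (fun u' => X u' *m J i u') u - nabla (g i) X X u *m J i u = 0.

(** * Second fundamental form of an immersion [psi] of an open set of R^n into
    an open set of R^m with metric [G] *)

Section LocalImmersion.
Variables (R : realType) (m n : nat).
Variables (G : 'rV[R]_m -> 'M[R]_m) (psi : 'rV[R]_n -> 'rV[R]_m).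

Definition induced_metric (u : 'rV[R]_n) : 'M[R]_n :=
  let A := jacobian psi u in A *m G (psi u) *m A^T.

(** By the Gauss formula h(X, Y) is the normal part of the ambient covariant
    derivative of Y in the direction X; as it depends only on the values of X
    and Y at the point, [w] is extended with constant components. *)
Definition sff (u v w : 'rV[R]_n) : 'rV[R]_m :=
  normal (G (psi u)) (jacobian psi u)
    (nabla_along G psi (fun u' => w *m jacobian psi u') u v).

Definition sff_sqnorm (u : 'rV[R]_n) : R :=
  let E := onframe (induced_metric u) in
  \sum_(i < n) \sum_(j < n)
    dotg (G (psi u)) (sff u (row i E) (row j E)) (sff u (row i E) (row j E)).

Definition mean_curvature (u : 'rV[R]_n) : 'rV[R]_m :=
  let E := onframe (induced_metric u) in
  n%:R^-1 *: \sum_(i < n) sff u (row i E) (row i E).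

Definition grad (F : 'rV[R]_n -> R) (u : 'rV[R]_n) : 'rV[R]_n :=
  xget 0 [set v | forall w, dotg (induced_metric u) v w = 'D_w F u].

Definition grad_sqnorm (F : 'rV[R]_n -> R) (u : 'rV[R]_n) : R :=
  dotg (induced_metric u) (grad F u) (grad F u).

End LocalImmersion.

(** * Submanifolds, as immersions [phi : N -> M] *)

Section Submanifold.
Variables (R : realType) (n m : nat) (N : charted R n) (M : charted R m).
Variable phi : N -> M.

Definition local_expr (i : idx N) (j : idx M) : 'rV[R]_n -> 'rV[R]_m :=
  crd M j \o phi \o par N i.

Definition charts_at (p : N) (i : idx N) (j : idx M) : Prop :=
  dom N i p /\ dom M j (phi p).

(** The rows of this matrix span the image of the tangent space of N at [p]. *)
Definition tangent_map (i : idx N) (j : idx M) (p : N) : 'M[R]_(n, m) :=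
  jacobian (local_expr i j) (crd N i p).

Definition is_immersion : Prop :=
  [/\ continuous phi,
      forall i j, smooth_on (crd N i @` [set p | charts_at p i j])
                            (local_expr i j)
    & forall p i j, charts_at p i j -> row_free (tangent_map i j p)].

Variables (J g : tensor2 M).

Definition acs_at (j : idx M) (p : N) : 'M[R]_m := J j (crd M j (phi p)).

Definition metric_at (j : idx M) (p : N) : 'M[R]_m := g j (crd M j (phi p)).

Definition is_holomorphic : Prop :=
  forall p i j, charts_at p i j ->
    (tangent_map i j p *m acs_at j p == tangent_map i j p)%MS.

Definition is_totally_real : Prop :=
  forall p i j, charts_at p i j -> forall v w : 'rV[R]_n,
    dotg (metric_at j p) (v *m tangent_map i j p *m acs_at j p)
                         (w *m tangent_map i j p) = 0.

Definition is_slant (theta : R) : Prop :=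
  forall p i j, charts_at p i j -> forall v : 'rV[R]_n, v != 0 ->
    angle_with (metric_at j p) (tangent_map i j p)
               (v *m tangent_map i j p *m acs_at j p) = theta.

Definition is_proper_slant (theta : R) : Prop :=
  [/\ is_slant theta, ~ is_holomorphic & ~ is_totally_real].

Definition is_totally_geodesic : Prop :=
  forall p i j, charts_at p i j -> forall v w : 'rV[R]_n,
    sff (g j) (local_expr i j) (crd N i p) v w = 0.

Definition is_totally_umbilical : Prop :=
  forall p i j, charts_at p i j -> forall v w : 'rV[R]_n,
    sff (g j) (local_expr i j) (crd N i p) v w =
    dotg (induced_metric (g j) (local_expr i j) (crd N i p)) v w *:
      mean_curvature (g j) (local_expr i j) (crd N i p).

Definition is_minimal : Prop :=
  forall p i j, charts_at p i j ->
    mean_curvature (g j) (local_expr i j) (crd N i p) = 0.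

End Submanifold.

(** * Warped products *)

Definition differentiable_function (R : realType) (n : nat) (N : charted R n)
    (f : N -> R) : Prop :=
  forall (i : idx N) u, chart_image i u -> differentiable (f \o par N i) u.

Definition warped_metric (R : realType) (a b : nat)
    (N1 : charted R a) (N2 : charted R b)
    (g1 : tensor2 N1) (g2 : tensor2 N2) (f : N1 -> R) :
    tensor2 (prod_charted N1 N2) :=
  fun i u => block_mx (g1 i.1 (lsubmx u)) 0
                      0 (f (par N1 i.1 (lsubmx u)) ^+ 2 *: g2 i.2 (rsubmx u)).

(** The immersion [phi] of N1 * N2, with its induced metric, is the warped
    product of (N1, g1) and (N2, g2) with warping function [f]. *)
Record is_warped_product_submanifold (R : realType) (a b m : nat)
    (N1 : manifold R a) (N2 : manifold R b) (M : manifold R m) (g : tensor2 M)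
    (g1 : tensor2 N1) (g2 : tensor2 N2) (f : N1 -> R)
    (phi : prod_charted N1 N2 -> M) : Prop := {
  wp_riemannian1 : is_riemannian g1;
  wp_riemannian2 : is_riemannian g2;
  wp_warping_pos : forall x, 0 < f x;
  wp_warping_diff : differentiable_function f;
  wp_immersion : is_immersion phi;
  wp_induced : forall p i j, charts_at phi p i j ->
    induced_metric (g j) (local_expr phi i j) (crd (prod_charted N1 N2) i p) =
    warped_metric g1 g2 f i (crd (prod_charted N1 N2) i p) }.

(** Both factors are regarded as submanifolds of the ambient manifold through
    the leaves N1 * {y} and {x} * N2. *)
Definition leaf1 (R : realType) (a b : nat) (N1 : charted R a)
    (N2 : charted R b) (M : Type) (phi : prod_charted N1 N2 -> M) (y : N2) :
    N1 -> M := fun x => phi (x, y).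

Definition leaf2 (R : realType) (a b : nat) (N1 : charted R a)
    (N2 : charted R b) (M : Type) (phi : prod_charted N1 N2 -> M) (x : N1) :
    N2 -> M := fun y => phi (x, y).

Record is_warped_semi_slant (R : realType) (a b m : nat)
    (NT : manifold R a) (Nth : manifold R b) (M : manifold R m)
    (J g : tensor2 M) (gT : tensor2 NT) (gth : tensor2 Nth) (f : NT -> R)
    (phi : prod_charted NT Nth -> M) (theta : R) : Prop := {
  wss_warped : is_warped_product_submanifold g gT gth f phi;
  wss_holomorphic : forall y : Nth, is_holomorphic (leaf1 phi y) J;
  wss_slant : forall x : NT, is_proper_slant (leaf2 phi x) J g theta }.

(** * Squared norms at a point of a submanifold *)

Definition sff_sqnorm_at (R : realType) (n m : nat) (N : charted R n)
    (M : charted R m) (g : tensor2 M) (phi : N -> M)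
    (p : N) (i : idx N) (j : idx M) : R :=
  sff_sqnorm (g j) (local_expr phi i j) (crd N i p).

Definition grad_sqnorm_at (R : realType) (n m : nat) (N : charted R n)
    (M : charted R m) (g : tensor2 M) (phi : N -> M) (F : N -> R)
    (p : N) (i : idx N) (j : idx M) : R :=
  grad_sqnorm (g j) (local_expr phi i j) (F \o par N i) (crd N i p).

(* Main.v *)
(* Let X be tangent to N_T and Z, W to N_theta, and put w(Z, W) = g(JZ, W).
   Since nabla J is totally skew on a nearly Kaehler manifold, the torsion-free
   connection and the warped metric give 3 g((nabla_X J) Z, W) = X w(Z, W), and
   hence, with eta_X = (X ln f) w - (1/3) X w,
     g(h(X, Z), JW) = - (JX ln f) g(Z, W) + eta_X(Z, W).
   The first term is symmetric and the second skew in Z, W, so that the squares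
   add up over a frame.  The slant condition fixes the norm of w with respect to
   the metric of N_theta before warping, hence <X w, w> = 2 (X ln f) |w|^2 and
   |eta_X|^2 >= (X ln f)^2 |w|^2 / 9.  As the normal parts of the vectors JW of
   an orthonormal frame have length sin theta and are orthogonal, Bessel's
   inequality bounds the mixed part of |h|^2, which already gives (i).  Equality
   forces h(X, Y) = 0 and h(Z, W) = 0, and (ii) follows because N_T is totally
   geodesic and N_theta is totally umbilical in a warped product. *)

(* Origin of the factor 3: with T(Z, W) = g((nabla_X J) Z, W), differentiating w(Z, W) along X gives
   T(Z, W) and two terms containing nabla_X Z and nabla_X W. Differentiating g(JX, W) = 0 along Z,
   and the same with Z and W exchanged, shows that these two terms are T(Z, W) and -T(W, Z), each up
   to the same multiple (JX ln f) g(Z, W), which cancels; skewness of T gives 3 T(Z, W). As X w has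
   component 2 (X ln f) w along w, the component of eta_X is (1 - 2/3)(X ln f) w, whence 1/9. Origin
   of the constant: with b = 2 beta, each X contributes b (JX ln f)^2 + (b/9) cos^2 theta (X ln
   f)^2, divided by sin^2 theta through Bessel. J is an isometry on N_T, so both sums over a frame
   are the squared norm of grad ln f, and the mixed part occurs twice in |h|^2. The computation uses
   coordinate fields of one product chart. Their brackets vanish, so torsion-freeness becomes
   symmetry of second derivatives. JX is not a coordinate field, but only its tangency to the first
   factor near the point is used. *)
Require Import Defs.
From mathcomp Require Import all_boot all_order all_algebra.
From mathcomp Require Import all_classical all_reals all_analysis.
From mathcomp Require Import ring lra.
Set Implicit Arguments.
Unset Strict Implicit.
Unset Printing Implicit Defensive.
Import Order.TTheory GRing.Theory Num.Theory.
Import numFieldNormedType.Exports.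
Local Open Scope classical_set_scope.
Local Open Scope ring_scope.

(** * Symmetry of second derivatives *)

Section Derivative.
Variables (R : realType) (V : normedModType R).

Lemma is_derive_line (W : normedModType R) (f : V -> W) (u v : V) (s : R) (df : W) :
  is_derive (u + s *: v) v f df ->
  is_derive s 1 (fun s : R => f (u + s *: v)) df.
Proof.
move=> [d dfE].
have E : (fun h : R => h^-1 *: (((fun s : R => f (u + s *: v)) \o shift s) (h *: 1) -
    f (u + s *: v))) =
   (fun h : R => h^-1 *: ((f \o shift (u + s *: v)) (h *: v) - f (u + s *: v))).
  apply/funext => h /=; congr (_ *: (f _ - _)).
  by rewrite [h *: 1]mulr1 scalerDl addrCA.
by split; [rewrite /derivable E|rewrite /derive E].
Qed.

(** The mean value theorem is applied twice: along [v] to the difference of [f] on two parallel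
    segments, then along [w] to [fv]. *)
Lemma second_difference_MVT (f fv fvw : V -> R) (u v w : V) (r : R) :
  (forall z, `|z - u| < r -> is_derive z v f (fv z)) ->
  (forall z, `|z - u| < r -> is_derive z w fv (fvw z)) ->
  forall t : R, 0 < t -> t * (`|v| + `|w|) < r ->
  exists2 z, `|z - u| < r &
    f (u + t *: v + t *: w) - f (u + t *: v) - f (u + t *: w) + f u =
    t ^+ 2 * fvw z.
Proof.
move=> dv dwv t t0 tr.
have near_u (s s' : R) : 0 <= s <= t -> 0 <= s' <= t ->
    `|u + s' *: w + s *: v - u| < r.
  move=> /andP[s0 st] /andP[s'0 s't]; apply: le_lt_trans tr.
  rewrite -[u + _ + _]addrA addrAC subrr add0r (le_trans (ler_normD _ _))// !normrZ !ger0_norm//.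
  by rewrite mulrDr addrC lerD// ler_wpM2r.
have tt : 0 <= t <= t by rewrite ltW//=.
have t00 : (0 : R) <= 0 <= t by rewrite lexx ltW.
have line (s' : R) s : 0 <= s <= t -> 0 <= s' <= t ->
    is_derive s 1 (fun s : R => f (u + s' *: w + s *: v))
      (fv (u + s' *: w + s *: v)).
  by move=> *; apply/is_derive_line/dv/near_u.
(* The vacuous shift [0 *: w] gives both segments the same form, so that [line] covers each of
   them. *)
pose g := (fun s : R => f (u + t *: w + s *: v)) - (fun s : R => f (u + 0 *: w + s *: v)).
have dg s : 0 <= s <= t -> is_derive s 1 g
    (fv (u + t *: w + s *: v) - fv (u + 0 *: w + s *: v)).
  by move=> st; apply: is_deriveB; apply: line.
have [s||s st gE] := @MVT R g (fun s =>
    (fv (u + t *: w + s *: v) - fv (u + 0 *: w + s *: v))) 0 t t0.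
- by rewrite in_itv/= => /andP[? ?]; apply: dg; rewrite !ltW.
- apply: derivable_within_continuous => s; rewrite in_itv/= => st.
  by have [] := dg _ st.
have {}st : 0 <= s <= t by move: st; rewrite in_itv/= => /andP[? ?]; rewrite !ltW.
have dk s' : 0 <= s' <= t -> is_derive s' 1
    (fun s' : R => fv (u + s *: v + s' *: w)) (fvw (u + s *: v + s' *: w)).
  by move=> s't; apply/is_derive_line/dwv; rewrite [u + _ + _]addrAC; exact: near_u.
have [s'||s' s't kE] := @MVT R (fun s' : R => fv (u + s *: v + s' *: w))
    (fun s' => fvw (u + s *: v + s' *: w)) 0 t t0.
- by rewrite in_itv/= => /andP[? ?]; apply: dk; rewrite !ltW.
- apply: derivable_within_continuous => x; rewrite in_itv/= => xt.
  by have [] := dk _ xt.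
have {}s't : 0 <= s' <= t by move: s't; rewrite in_itv/= => /andP[? ?]; rewrite !ltW.
exists (u + s *: v + s' *: w); first by rewrite [u + _ + _]addrAC near_u.
move: gE kE; rewrite /g !fctE !scale0r !addr0 !subr0.
rewrite ![u + _ *: w + _]addrAC => gE kE.
by rewrite expr2 -mulrA [t * fvw _]mulrC -kE mulrC -gE; ring.
Qed.

(** The second difference is symmetric in [v] and [w], so the two mixed derivatives agree at two
    points that may be taken arbitrarily close to [u]; continuity brings them to [u]. *)
Lemma derive_comm (f fv fw fvw fwv : V -> R) (u v w : V) :
  (\forall z \near u, is_derive z v f (fv z) /\ is_derive z w f (fw z)) ->
  (\forall z \near u, is_derive z w fv (fvw z) /\ is_derive z v fw (fwv z)) ->
  {for u, continuous fvw} -> {for u, continuous fwv} -> fvw u = fwv u.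
Proof.
move=> d1 d2 c1 c2; apply/eqP; rewrite -subr_eq0 -normr_le0.
apply/ler_addgt0Pl => e e0; rewrite addr0.
have e20 : 0 < e / 2 by rewrite divr_gt0.
move/cvgrPdist_lt : c1 => /(_ _ e20) c1; move/cvgrPdist_lt : c2 => /(_ _ e20) c2.
have /nbhs_ballP[r /= r0] : \forall z \near u,
    ((is_derive z v f (fv z) /\ is_derive z w f (fw z)) /\
     (is_derive z w fv (fvw z) /\ is_derive z v fw (fwv z))) /\
    (`|fvw u - fvw z| < e / 2 /\
     `|fwv u - fwv z| < e / 2).
  by apply: filterI; apply: filterI.
rewrite -ball_normE => near_u.
have near_u' z : `|z - u| < r -> [/\ is_derive z v f (fv z) /\ is_derive z w f (fw z),
   is_derive z w fv (fvw z) /\ is_derive z v fw (fwv z),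
   `|fvw u - fvw z| < e / 2 &
   `|fwv u - fwv z| < e / 2].
  move=> zr; have [|[d1z d2z] [c1z c2z]] := near_u z; first by rewrite /= distrC.
  by split.
have [t t0 tr] : exists2 t : R, 0 < t & t * (`|v| + `|w|) < r.
  exists (r / (`|v| + `|w| + 1)); first by rewrite divr_gt0// ltr_wpDl// addr_ge0.
  rewrite mulrAC ltr_pdivrMr ?ltr_wpDl ?addr_ge0//.
  by rewrite ltr_pM2l// ltrDl.
have [|||z1 z1r E1] := @second_difference_MVT f fv fvw u v w r _ _ t t0.
- by move=> z zr; have [+ _ _ _] := near_u' z zr; case.
- by move=> z zr; have [_ + _ _] := near_u' z zr; case.
- by [].
have [|||z2 z2r E2] := @second_difference_MVT f fw fwv u w v r _ _ t t0.
- by move=> z zr; have [+ _ _ _] := near_u' z zr; case.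
- by move=> z zr; have [_ + _ _] := near_u' z zr; case.
- by rewrite addrC.
have E : fvw z1 = fwv z2.
  have : t ^+ 2 * fvw z1 = t ^+ 2 * fwv z2.
    by rewrite -E1 -E2 [u + t *: v + t *: w]addrAC; ring.
  by apply: mulfI; rewrite expf_eq0/= gt_eqF.
have [_ _ + _] := near_u' _ z1r; have [_ _ _] := near_u' _ z2r.
rewrite E distrC => h2 h1; rewrite (splitr e) -(subrKA (fwv z2)).
by rewrite (le_trans (ler_normD _ _))// lerD ?ltW// distrC.
Qed.

End Derivative.

(** * Directional derivatives of matrix-valued maps *)

Section MatrixDerivative.
Variables (R : realType) (V : normedModType R).

Lemma is_derive_mxP (m n : nat) (M : V -> 'M[R]_(m, n)) (x v : V) (dM : 'M[R]_(m, n)) :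
  is_derive x v M dM <->
  forall i j, is_derive x v (fun y => M y i j) (dM i j).
Proof.
split=> [[d <-] i j|dM_ij].
  split; first exact: (derivable_mxP M x v).1.
  by rewrite derive_mx// mxE.
have d : derivable M x v by apply/derivable_mxP => i j; have [] := dM_ij i j.
split=> //; rewrite derive_mx//; apply/matrixP => i j; rewrite mxE.
by have [] := dM_ij i j.
Qed.

Lemma is_derive_sumr (I : Type) (r : seq I) (W : normedModType R) (h : I -> V -> W)
    (x v : V) (dh : I -> W) :
  (forall i, is_derive x v (h i) (dh i)) ->
  is_derive x v (fun y => \sum_(i <- r) h i y) (\sum_(i <- r) dh i).
Proof.
move=> dhi; elim: r => [|i r IH].
  under eq_fun do rewrite big_nil.
  by rewrite big_nil; exact: is_derive_cst.
under eq_fun do rewrite big_cons.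
by rewrite big_cons; apply: is_deriveD.
Qed.

Lemma is_derive_mulmx (m n p : nat) (M : V -> 'M[R]_(m, n)) (N : V -> 'M[R]_(n, p))
    (x v : V) (dM : 'M[R]_(m, n)) (dN : 'M[R]_(n, p)) :
  is_derive x v M dM -> is_derive x v N dN ->
  is_derive x v (fun y => M y *m N y) (dM *m N x + M x *m dN).
Proof.
move=> /is_derive_mxP dMij /is_derive_mxP dNij; apply/is_derive_mxP => i k.
under eq_fun do rewrite mxE.
rewrite !mxE -big_split/=; apply: is_derive_sumr => j.
have d := is_deriveM (dMij i j) (dNij j k); apply: (is_derive_eq d).
by rewrite addrC /GRing.scale/=; congr (_ + _); rewrite mulrC.
Qed.

Lemma is_derive_mulmxl (m n p : nat) (M : 'M[R]_(m, n)) (N : V -> 'M[R]_(n, p))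
    (x v : V) (dN : 'M[R]_(n, p)) :
  is_derive x v N dN -> is_derive x v (fun y => M *m N y) (M *m dN).
Proof.
move=> d; apply: (is_derive_eq (is_derive_mulmx (is_derive_cst M x v) d)).
by rewrite mul0mx add0r.
Qed.

Lemma is_derive_trmx (m n : nat) (M : V -> 'M[R]_(m, n)) (x v : V) (dM : 'M[R]_(m, n)) :
  is_derive x v M dM -> is_derive x v (fun y => (M y)^T) dM^T.
Proof.
move=> /is_derive_mxP dMij; apply/is_derive_mxP => i j.
by under eq_fun do rewrite mxE; rewrite mxE.
Qed.

Lemma is_derive_mxtrace (n : nat) (M : V -> 'M[R]_n) (x v : V) (dM : 'M[R]_n) :
  is_derive x v M dM -> is_derive x v (fun y => \tr (M y)) (\tr dM).
Proof. by move=> /is_derive_mxP dMij; apply: is_derive_sumr => i; exact: dMij. Qed.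

Lemma is_derive_dotg (m : nat) (G : V -> 'M[R]_m) (W1 W2 : V -> 'rV[R]_m)
    (x v : V) (dG : 'M[R]_m) (d1 d2 : 'rV[R]_m) :
  is_derive x v G dG -> is_derive x v W1 d1 -> is_derive x v W2 d2 ->
  is_derive x v (fun y => dotg (G y) (W1 y) (W2 y))
    (dotg (G x) d1 (W2 x) + dotg (G x) (W1 x) d2 + dotg dG (W1 x) (W2 x)).
Proof.
move=> dG' dW1 dW2.
have := is_derive_mulmx (is_derive_mulmx dW1 dG') (is_derive_trmx dW2).
move=> /is_derive_mxP/(_ 0 0) d; apply: (is_derive_eq d).
by rewrite /dotg !mulmxDl !mxE; ring.
Qed.

(* No regularity of [f] is needed: the difference quotients along [v] vanish. *)
Lemma is_derive_invariant (W : normedModType R) (f : V -> W) (x v : V) :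
  (forall h : R, f (h *: v + x) = f x) -> is_derive x v f 0.
Proof.
move=> fE; have E : (fun h : R => h^-1 *: ((f \o shift x) (h *: v) - f x)) = cst 0.
  by apply/funext => h /=; rewrite fE subrr scaler0.
split; rewrite ?/derivable ?/derive E; first exact: is_cvg_cst.
by apply/cvg_lim => //; exact: cvg_cst.
Qed.

(** The device by which an identity valid near a point is differentiated. *)
Lemma is_derive_near_unique (W : normedModType R) (f g : V -> W) (x v : V) (df dg : W) :
  (\near x, f x = g x) -> is_derive x v f df -> is_derive x v g dg -> df = dg.
Proof.
move=> fg df' dg'; have := near_eq_is_derive fg df'.
by move=> [_ <-]; case: dg' => _ <-.
Qed.

Lemma differentiable_is_derive (W : normedModType R) (f : V -> W) (x v : V) :
  differentiable f x -> is_derive x v f ('D_v f x).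
Proof. by move=> /diff_derivable /derivableP. Qed.

Lemma deriveDl (W : normedModType R) (f : V -> W) (x v w : V) : differentiable f x ->
  'D_(v + w) f x = 'D_v f x + 'D_w f x.
Proof. by move=> d; rewrite !deriveE// linearD. Qed.

Lemma deriveZl (W : normedModType R) (f : V -> W) (x v : V) (a : R) :
  differentiable f x -> 'D_(a *: v) f x = a *: 'D_v f x.
Proof. by move=> d; rewrite !deriveE// linearZ. Qed.

End MatrixDerivative.

Section DeriveCoordinates.
Variables (R : realType) (n : nat) (W : normedModType R).
Implicit Types (f : 'rV[R]_n -> W).

Lemma derive_row_sum f (x v : 'rV[R]_n) : differentiable f x ->
  'D_v f x = \sum_i v 0 i *: 'D_(delta_mx 0 i) f x.
Proof.
move=> d; rewrite deriveE// [in LHS](row_sum_delta v) linear_sum.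
by apply: eq_bigr => i _; rewrite linearZ deriveE.
Qed.

End DeriveCoordinates.

Lemma is_derive_comp (R : realType) (V V' W : normedModType R) (f : V -> V') (g : V' -> W)
    (x v : V) : differentiable f x -> differentiable g (f x) ->
  is_derive x v (g \o f) ('D_('D_v f x) g (f x)).
Proof.
move=> df dg.
have dgf : differentiable (g \o f) x by exact: differentiable_comp.
split; first exact: diff_derivable.
by rewrite !deriveE// diff_comp.
Qed.

Section Smooth.
Variables (R : realType) (n : nat) (W : normedModType R) (U : set 'rV[R]_n).
Implicit Types (f : 'rV[R]_n -> W).

Lemma smooth_cst (c : W) : smooth_on U (fun=> c).
Proof.
suff Ck_cst k : forall c, Ck k U (fun=> c : W) by move=> k.
elim: k => [|k IH] d /=; first by move=> u _; apply: cst_continuous.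
split=> [u _|i]; first exact: differentiable_cst.
rewrite (_ : (fun u => _) = (fun=> 0 : W)); first exact: IH.
by apply/funext => u; exact: derive_cst.
Qed.

Lemma smooth_differentiable f u : smooth_on U f -> U u -> differentiable f u.
Proof. by move=> fS; case: (fS 1%N) => + _; exact. Qed.

Lemma smooth_derive f i : smooth_on U f -> smooth_on U (fun u => 'D_(delta_mx 0 i) f u).
Proof. by move=> fS k; have [_ fk] := fS k.+1; exact: fk. Qed.

Lemma smooth_continuous f u : smooth_on U f -> U u -> {for u, continuous f}.
Proof. by move=> fS; exact: (fS 0%N). Qed.

End Smooth.

(** * Connections *)

Section DotgTheory.
Variables (R : realType) (m : nat).
Implicit Types (G H : 'M[R]_m) (u v w : 'rV[R]_m).

Lemma dotgDl G u v w : dotg G (u + v) w = dotg G u w + dotg G v w.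
Proof. by rewrite /dotg !mulmxDl mxE. Qed.

Lemma dotgDr G u v w : dotg G u (v + w) = dotg G u v + dotg G u w.
Proof. by rewrite /dotg linearD mulmxDr mxE. Qed.

Lemma dotgZl G a v w : dotg G (a *: v) w = a * dotg G v w.
Proof. by rewrite /dotg -!scalemxAl mxE. Qed.

Lemma dotgZr G a v w : dotg G v (a *: w) = a * dotg G v w.
Proof. by rewrite /dotg linearZ/= -scalemxAr mxE. Qed.

Lemma dotgNl G v w : dotg G (- v) w = - dotg G v w.
Proof. by rewrite -scaleN1r dotgZl mulN1r. Qed.

Lemma dotgNr G v w : dotg G v (- w) = - dotg G v w.
Proof. by rewrite -scaleN1r dotgZr mulN1r. Qed.

Lemma dotgBl G u v w : dotg G (u - v) w = dotg G u w - dotg G v w.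
Proof. by rewrite dotgDl dotgNl. Qed.

Lemma dotgBr G u v w : dotg G u (v - w) = dotg G u v - dotg G u w.
Proof. by rewrite dotgDr dotgNr. Qed.

Lemma dotg0l G v : dotg G 0 v = 0.
Proof. by rewrite /dotg !mul0mx mxE. Qed.

Lemma dotg0r G v : dotg G v 0 = 0.
Proof. by rewrite /dotg trmx0 mulmx0 mxE. Qed.

Lemma dotg_suml G (I : Type) (r : seq I) (f : I -> 'rV[R]_m) w :
  dotg G (\sum_(i <- r) f i) w = \sum_(i <- r) dotg G (f i) w.
Proof. by elim/big_rec2: _ => [|i x y _ <-]; rewrite ?dotg0l ?dotgDl. Qed.

Lemma dotg_sumr G (I : Type) (r : seq I) (f : I -> 'rV[R]_m) w :
  dotg G w (\sum_(i <- r) f i) = \sum_(i <- r) dotg G w (f i).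
Proof. by elim/big_rec2: _ => [|i x y _ <-]; rewrite ?dotg0r ?dotgDr. Qed.

Lemma dotgDm G H v w : dotg (G + H) v w = dotg G v w + dotg H v w.
Proof. by rewrite /dotg mulmxDr mulmxDl mxE. Qed.

Lemma dotgZm a G v w : dotg (a *: G) v w = a * dotg G v w.
Proof. by rewrite /dotg -scalemxAr -scalemxAl mxE. Qed.

Lemma dotgNm G v w : dotg (- G) v w = - dotg G v w.
Proof. by rewrite -scaleN1r dotgZm mulN1r. Qed.

Lemma dotg_tr G v w : dotg G^T v w = dotg G w v.
Proof.
have -> : dotg G w v = (w *m G *m v^T)^T 0 0 by rewrite mxE.
by rewrite !trmx_mul trmxK mulmxA.
Qed.

Lemma dotgC G v w : G^T = G -> dotg G v w = dotg G w v.
Proof. by move=> Gs; rewrite -{1}Gs dotg_tr. Qed.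

Lemma dotg_congr n (A : 'M[R]_(n, m)) G (v w : 'rV[R]_n) :
  dotg (A *m G *m A^T) v w = dotg G (v *m A) (w *m A).
Proof. by rewrite /dotg trmx_mul !mulmxA. Qed.

Lemma dotg_delta G i j : dotg G (delta_mx 0 i) (delta_mx 0 j) = G i j.
Proof. by rewrite /dotg -rowE trmx_delta -colE !mxE. Qed.

Lemma dotg_sumE G v w : dotg G v w = \sum_i \sum_j v 0 i * G i j * w 0 j.
Proof.
rewrite /dotg mxE exchange_big; apply: eq_bigr => j _.
by rewrite !mxE mulr_suml.
Qed.

Lemma dotg_inj G H : (forall v w, dotg G v w = dotg H v w) -> G = H.
Proof. by move=> GH; apply/matrixP => i j; rewrite -!dotg_delta GH. Qed.

(** Polarization. *)
Lemma dotg_sym_inj G H : G^T = G -> H^T = H ->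
  (forall v, dotg G v v = dotg H v v) -> G = H.
Proof.
move=> Gs Hs GH; apply: dotg_inj => v w; have := GH (v + w).
rewrite !dotgDl !dotgDr !GH (dotgC w v Gs) (dotgC w v Hs) => E.
have {}E : 2 * (dotg G v w - dotg H v w) = 0 by rewrite mulrBr; lra.
by move/eqP : E; rewrite mulf_eq0 pnatr_eq0/= subr_eq0 => /eqP.
Qed.

Lemma dotg_eq0 G v : G \in unitmx -> (forall w, dotg G v w = 0) -> v = 0.
Proof.
move=> Gu Gv; suff : v *m G = 0 by move/(canRL (mulmxK Gu)); rewrite mul0mx.
apply/rowP => j; have := Gv (delta_mx 0 j); rewrite /dotg trmx_delta -colE.
by rewrite !mxE.
Qed.

Definition posdef G := forall v, v != 0 -> 0 < dotg G v v.

Lemma posdef_unit G : posdef G -> G \in unitmx.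
Proof.
move=> Gp; rewrite -row_free_unit -kermx_eq0; apply/rowV0P => v /sub_kermxP vG.
by apply/eqP/negPn/negP => /Gp; rewrite /dotg vG mul0mx mxE ltxx.
Qed.

Lemma posdef_ge0 G v : posdef G -> 0 <= dotg G v v.
Proof.
move=> Gp; have [->|/Gp/ltW//] := eqVneq v 0; by rewrite dotg0l.
Qed.

Lemma posdef_eq0 G v : posdef G -> dotg G v v = 0 -> v = 0.
Proof.
by move=> Gp vv; apply/eqP/negPn/negP => /Gp; rewrite vv ltxx.
Qed.

End DotgTheory.

Section LeviCivita.
Variables (R : realType) (m : nat) (G : 'rV[R]_m -> 'M[R]_m) (u : 'rV[R]_m).
Hypothesis Gd : differentiable G u.
Hypothesis Gsym : \near u, (G u)^T = G u.
Hypothesis Gunit : G u \in unitmx.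

Lemma dmetricE k i j : dmetric G u k i j = 'D_(delta_mx 0 k) G u i j.
Proof.
have /is_derive_mxP/(_ i j)[_ <-] // :=
  differentiable_is_derive (delta_mx 0 k : 'rV[R]_m) Gd.
Qed.

Lemma dmetricC k i j : dmetric G u k i j = dmetric G u k j i.
Proof.
rewrite /dmetric; apply: near_eq_derive; near=> y.
have Gy : (G y)^T = G y by near: y.
by rewrite -[in LHS]Gy mxE.
Unshelve. all: by end_near. Qed.

Lemma derive_metric_sum v w z :
  dotg ('D_v G u) w z = \sum_k \sum_i \sum_j dmetric G u k i j * v 0 k * w 0 i * z 0 j.
Proof.
rewrite derive_row_sum//.
transitivity (\sum_k v 0 k * dotg ('D_(delta_mx 0 k) G u) w z).
  elim/big_rec2: _ => [|k x y _ <-]; last by rewrite dotgDm dotgZm.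
  by rewrite /dotg mulmx0 mul0mx mxE.
apply: eq_bigr => k _; rewrite dotg_sumE mulr_sumr; apply: eq_bigr => i _.
by rewrite mulr_sumr; apply: eq_bigr => j _; rewrite -dmetricE; ring.
Qed.

Lemma christoffel_formC v w : christoffel_form G u v w = christoffel_form G u w v.
Proof.
apply/rowP => k; rewrite !mxE exchange_big; apply: eq_bigr => i _.
apply: eq_bigr => j _; rewrite mulrAC; congr (_ * _ * _); congr (_ * _).
by apply: eq_bigr => l _; rewrite (dmetricC l) [dmetric G u j i l + _]addrC.
Qed.

Lemma christoffel_formDr v w1 w2 : christoffel_form G u v (w1 + w2) =
  christoffel_form G u v w1 + christoffel_form G u v w2.
Proof.
apply/rowP => k; rewrite !mxE -big_split; apply: eq_bigr => i _.
by rewrite -big_split; apply: eq_bigr => j _; rewrite mxE mulrDr.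
Qed.

Lemma christoffel_formZr v a w :
  christoffel_form G u v (a *: w) = a *: christoffel_form G u v w.
Proof.
apply/rowP => k; rewrite !mxE mulr_sumr; apply: eq_bigr => i _.
by rewrite mulr_sumr; apply: eq_bigr => j _; rewrite mxE; ring.
Qed.

Lemma christoffel_formDl v1 v2 w : christoffel_form G u (v1 + v2) w =
  christoffel_form G u v1 w + christoffel_form G u v2 w.
Proof. by rewrite !(christoffel_formC _ w) christoffel_formDr. Qed.

(** Koszul's formula for constant fields: pairing with [G u] lowers the upper index of the
    Christoffel symbols and cancels the inverse matrix in their definition. *)
Lemma dotg_christoffel v w z :
  dotg (G u) (christoffel_form G u v w) z = 2^-1 *
    (dotg ('D_v G u) w z + dotg ('D_w G u) v z - dotg ('D_z G u) v w).
Proof.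
have Gu : (G u)^T = G u := nbhs_singleton Gsym.
have lower i j l : \sum_k christoffel G u k i j * G u k l =
    2^-1 * (dmetric G u i j l + dmetric G u j i l - dmetric G u l i j).
  under eq_bigr do rewrite /christoffel -mulrA mulr_suml.
  rewrite -mulr_sumr; congr (_ * _); rewrite exchange_big/=.
  transitivity (\sum_l' (dmetric G u i j l' + dmetric G u j i l' - dmetric G u l' i j) *
      (G u *m invmx (G u)) l l').
    apply: eq_bigr => l' _; rewrite mxE mulr_sumr; apply: eq_bigr => k _.
    by rewrite -{3}Gu mxE; ring.
  rewrite mulmxV// (bigD1 l)//= big1 ?addr0 => [|k kl]; rewrite !mxE ?eqxx ?mulr1//.
  by rewrite eq_sym (negbTE kl) mulr0.
transitivity (\sum_i \sum_j \sum_l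
    (\sum_k christoffel G u k i j * G u k l) * v 0 i * w 0 j * z 0 l).
  rewrite dotg_sumE exchange_big/=.
  under eq_bigr do under eq_bigr do rewrite mxE !mulr_suml.
  under eq_bigr do rewrite exchange_big/=.
  rewrite exchange_big/=; apply: eq_bigr => i _.
  under eq_bigr do under eq_bigr do rewrite !mulr_suml.
  under eq_bigr do rewrite exchange_big/=.
  rewrite exchange_big/=; apply: eq_bigr => j _; apply: eq_bigr => l _.
  by rewrite !mulr_suml; apply: eq_bigr => k _; ring.
rewrite !derive_metric_sum [X in _ + X - _]exchange_big/=.
have -> : \sum_k \sum_i \sum_j dmetric G u k i j * z 0 k * v 0 i * w 0 j =
    \sum_i \sum_j \sum_k dmetric G u k i j * z 0 k * v 0 i * w 0 j.
  by rewrite exchange_big/=; apply: eq_bigr => i _; rewrite exchange_big.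
rewrite -big_split/= -sumrB mulr_sumr; apply: eq_bigr => i _.
rewrite -big_split/= -sumrB mulr_sumr; apply: eq_bigr => j _.
rewrite -big_split/= -sumrB mulr_sumr; apply: eq_bigr => l _.
by rewrite lower; ring.
Qed.

Lemma derive_metric_sym v : ('D_v G u)^T = 'D_v G u.
Proof.
have d := differentiable_is_derive v Gd.
exact: (is_derive_near_unique Gsym (is_derive_trmx d) d).
Qed.

(** Metric compatibility. In the sum of the two instances of [dotg_christoffel] the derivatives
    along [w] and [z] cancel. *)
Lemma derive_metric v w z : dotg ('D_v G u) w z =
  dotg (G u) (christoffel_form G u v w) z + dotg (G u) w (christoffel_form G u v z).
Proof.
have Gu : (G u)^T = G u := nbhs_singleton Gsym.
rewrite (dotgC w _ Gu) !dotg_christoffel (dotgC z w (derive_metric_sym v)); lra.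
Qed.

End LeviCivita.

Section CovariantDerivativeAcs.
Variables (R : realType) (m : nat) (G J : 'rV[R]_m -> 'M[R]_m) (u : 'rV[R]_m).
Hypothesis Gd : differentiable G u.
Hypothesis Jd : differentiable J u.
Hypothesis Gsym : \near u, (G u)^T = G u.
Hypothesis Gunit : G u \in unitmx.
Hypothesis Jskew : \near u, J u *m G u = - (G u *m (J u)^T).

(* The components of (nabla_v J) w; [w] is extended by a constant. *)
Definition cov_acs (v w : 'rV[R]_m) : 'rV[R]_m :=
  w *m 'D_v J u + christoffel_form G u v (w *m J u) - christoffel_form G u v w *m J u.

Hypothesis nk : forall v, cov_acs v v = 0.

Lemma cov_acsDl v1 v2 w : cov_acs (v1 + v2) w = cov_acs v1 w + cov_acs v2 w.
Proof.
rewrite /cov_acs deriveDl// mulmxDr !christoffel_formDl// mulmxDl.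
by rewrite opprD; do ![rewrite -!addrA; congr (_ + _)| rewrite [LHS]addrC -!addrA; congr (_ + _)].
Qed.

Lemma cov_acsDr v w1 w2 : cov_acs v (w1 + w2) = cov_acs v w1 + cov_acs v w2.
Proof.
by rewrite /cov_acs !mulmxDl !christoffel_formDr mulmxDl opprD [RHS]addrACA
  [X in _ = X + _]addrACA.
Qed.

(** Polarization of the nearly Kaehler condition. *)
Lemma cov_acsC v w : cov_acs v w = - cov_acs w v.
Proof.
apply/eqP; rewrite -addr_eq0; apply/eqP; have := nk (v + w).
by rewrite cov_acsDl !cov_acsDr !nk add0r addr0.
Qed.

Lemma dotg_acs v w : dotg (G u) (v *m J u) w = - dotg (G u) v (w *m J u).
Proof.
have Ju := nbhs_singleton Jskew.
rewrite /dotg -(mulmxA v) Ju trmx_mul mulmxN mulNmx mxE.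
by rewrite !mulmxA.
Qed.

(** J is skew for the metric and the metric is parallel, so the covariant derivative of J is skew as
    well. With [cov_acsC] this makes it totally skew. *)
Lemma dotg_cov_acs_skew v w z :
  dotg (G u) (cov_acs v w) z = - dotg (G u) (cov_acs v z) w.
Proof.
have Gu := nbhs_singleton Gsym.
(* The identity [Jskew] differentiated along [v] and evaluated on [w] and [z]. *)
have JG : dotg (G u) (w *m 'D_v J u) z + dotg (G u) (z *m 'D_v J u) w =
    - (dotg ('D_v G u) (w *m J u) z + dotg ('D_v G u) w (z *m J u)).
  have dG := differentiable_is_derive v Gd; have dJ := differentiable_is_derive v Jd.
  have := is_derive_near_unique Jskew (is_derive_mulmx dJ dG)
    (is_deriveN (is_derive_mulmx dG (is_derive_trmx dJ))).
  rewrite (dotgC _ w Gu) /dotg => /(congr1 (fun M => (w *m M *m z^T) 0 0)).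
  rewrite !trmx_mul !(mulmxDr, mulmxDl, mulmxN, mulNmx) !mulmxA !mxE.
  lra.
rewrite /cov_acs !dotgBl !dotgDl !dotg_acs.
have := derive_metric Gd Gsym Gunit v (w *m J u) z.
have := derive_metric Gd Gsym Gunit v w (z *m J u).
rewrite (dotgC (christoffel_form _ _ _ (z *m _)) _ Gu).
rewrite [X in _ = X + _ -> _](dotgC _ _ Gu).
rewrite [dotg _ (_ *m _) (christoffel_form _ _ _ _)](dotgC _ _ Gu).
rewrite !(dotgC _ (_ *m J u) Gu).
lra.
Qed.

End CovariantDerivativeAcs.

Section AlongMap.
Variables (R : realType) (n m : nat) (G J : 'rV[R]_m -> 'M[R]_m).
Variables (psi : 'rV[R]_n -> 'rV[R]_m) (u : 'rV[R]_n).
Hypothesis psid : differentiable psi u.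
Hypothesis Gd : differentiable G (psi u).
Hypothesis Gsym : \forall y \near psi u, (G y)^T = G y.
Hypothesis Gunit : G (psi u) \in unitmx.

Lemma is_derive_metric_along (v : 'rV[R]_n) (V W : 'rV[R]_n -> 'rV[R]_m) :
  derivable V u v -> derivable W u v ->
  is_derive u v (fun u' => dotg (G (psi u')) (V u') (W u'))
    (dotg (G (psi u)) (nabla_along G psi V u v) (W u) +
     dotg (G (psi u)) (V u) (nabla_along G psi W u v)).
Proof.
move=> /derivableP dV /derivableP dW.
have d := is_derive_dotg (is_derive_comp v psid Gd) dV dW.
apply: (is_derive_eq d); rewrite /= (deriveEjacobian v psid) derive_metric//.
by rewrite /nabla_along dotgDl dotgDr; ring.
Qed.

Hypothesis Jd : differentiable J (psi u).

Lemma is_derive_acs_along (v : 'rV[R]_n) (V : 'rV[R]_n -> 'rV[R]_m) :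
  derivable V u v ->
  is_derive u v (fun u' => V u' *m J (psi u'))
    ('D_v V u *m J (psi u) + V u *m 'D_(v *m jacobian psi u) J (psi u)).
Proof.
move=> /derivableP dV.
have d := is_derive_mulmx dV (is_derive_comp v psid Jd).
by apply: (is_derive_eq d); rewrite /= (deriveEjacobian v psid).
Qed.

(** Leibniz rule for J applied to a field along [psi]: both sides share the derivatives of [V] and
    of J, and the two Christoffel terms are regrouped into [cov_acs]. *)
Lemma nabla_along_acs (v : 'rV[R]_n) (V : 'rV[R]_n -> 'rV[R]_m) :
  derivable V u v ->
  nabla_along G psi (fun u' => V u' *m J (psi u')) u v =
  nabla_along G psi V u v *m J (psi u) +
  cov_acs G J (psi u) (v *m jacobian psi u) (V u).
Proof.
move=> dV; rewrite /nabla_along (@derive_val _ _ _ _ _ _ _ (is_derive_acs_along dV)).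
rewrite /cov_acs mulmxDl -!addrA; congr (_ + _); rewrite addrCA; congr (_ + _).
by rewrite addrC subrK.
Qed.

End AlongMap.

Section CoordinateFields.
Variables (R : realType) (n m : nat) (U : set 'rV[R]_n) (psi : 'rV[R]_n -> 'rV[R]_m).
Hypothesis Uopen : open U.
Hypothesis psis : smooth_on U psi.
Implicit Types (u v w : 'rV[R]_n).

(** Push-forward by [psi] of the constant field [w]. Such fields commute, which is what makes [hess]
    symmetric. *)
Definition coord_field w u : 'rV[R]_m := w *m jacobian psi u.

Lemma coord_fieldE w u : U u ->
  coord_field w u = \sum_i w 0 i *: 'D_(delta_mx 0 i) psi u.
Proof.
move=> Uu; have d := smooth_differentiable psis Uu.
by rewrite -derive_row_sum// deriveEjacobian.
Qed.

(** Smoothness speaks of partial derivatives and not of the Jacobian matrix, so the field is first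
    replaced, near [u], by a combination of partial derivatives of [psi]. *)
Lemma is_derive_coord_field v w u : U u ->
  is_derive u v (coord_field w)
    (\sum_i w 0 i *: \sum_j v 0 j *: 'D_(delta_mx 0 j) ('D_(delta_mx 0 i) psi) u).
Proof.
move=> Uu.
have E : \near u, \sum_i w 0 i *: 'D_(delta_mx 0 i) psi u = coord_field w u.
  by have := open_nbhs_nbhs (conj Uopen Uu); apply: filterS => u' /(coord_fieldE w) ->.
apply: (near_eq_is_derive E); apply: is_derive_sumr => i.
have d := smooth_differentiable (smooth_derive i psis) Uu.
by rewrite -derive_row_sum//; apply/is_deriveZ/differentiable_is_derive.
Qed.

Lemma derivable_coord_field v w u : U u -> derivable (coord_field w) u v.
Proof. by move=> /(is_derive_coord_field v w) []. Qed.

Lemma derive_coordC i j u : U u ->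
  'D_(delta_mx 0 j) ('D_(delta_mx 0 i) psi) u = 'D_(delta_mx 0 i) ('D_(delta_mx 0 j) psi) u.
Proof.
move=> Uu; apply/rowP => k.
have d1 z a : U z ->
    is_derive z (delta_mx 0 a) (fun y => psi y 0 k) ('D_(delta_mx 0 a) psi z 0 k).
  move=> Uz; have := differentiable_is_derive (delta_mx 0 a) (smooth_differentiable psis Uz).
  by move=> /is_derive_mxP/(_ 0 k).
have d2 z a b : U z ->
    is_derive z (delta_mx 0 b) (fun y => 'D_(delta_mx 0 a) psi y 0 k)
      ('D_(delta_mx 0 b) ('D_(delta_mx 0 a) psi) z 0 k).
  move=> Uz; have := differentiable_is_derive (delta_mx 0 b)
    (smooth_differentiable (smooth_derive a psis) Uz).
  by move=> /is_derive_mxP/(_ 0 k).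
have c a b : {for u, continuous (fun y => 'D_(delta_mx 0 b) ('D_(delta_mx 0 a) psi) y 0 k)}.
  have := smooth_continuous (smooth_derive b (smooth_derive a psis)) Uu.
  move=> cab; apply: (@continuous_comp _ _ _ _ (fun M : 'rV[R]_m => M 0 k)) => //.
  exact: coord_continuous.
have UU : \near u, U u by exact: (open_nbhs_nbhs (conj Uopen Uu)).
apply: (derive_comm _ _ (c i j) (c j i)).
  by apply: filterS UU => z Uz; split; [exact: (d1 z i)|exact: (d1 z j)].
by apply: filterS UU => z Uz; split; [exact: (d2 z i j)|exact: (d2 z j i)].
Qed.

Lemma derive_coord_fieldC v w u : U u ->
  'D_v (coord_field w) u = 'D_w (coord_field v) u.
Proof.
move=> Uu; have [_ ->] := is_derive_coord_field v w Uu.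
have [_ ->] := is_derive_coord_field w v Uu.
under eq_bigr do rewrite scaler_sumr.
rewrite exchange_big/=; apply: eq_bigr => i _; rewrite scaler_sumr.
by apply: eq_bigr => j _; rewrite derive_coordC// !scalerA mulrC.
Qed.

Lemma derive_coord_fieldDr v w1 w2 u : U u ->
  'D_v (coord_field (w1 + w2)) u = 'D_v (coord_field w1) u + 'D_v (coord_field w2) u.
Proof.
move=> Uu; rewrite -deriveD; last 2 first.
- exact: derivable_coord_field.
- exact: derivable_coord_field.
by congr ('D_v _ u); apply/funext => u'; rewrite /coord_field mulmxDl.
Qed.

Lemma derive_coord_fieldZr v a w u : U u ->
  'D_v (coord_field (a *: w)) u = a *: 'D_v (coord_field w) u.
Proof.
move=> Uu; rewrite -deriveZ; last exact: derivable_coord_field.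
by congr ('D_v _ u); apply/funext => u'; rewrite /coord_field -scalemxAl.
Qed.

Variable G : 'rV[R]_m -> 'M[R]_m.

(* The second fundamental form is the normal part of [hess]. *)
Definition hess u v w := nabla_along G psi (coord_field w) u v.

Lemma hessDr v w1 w2 u : U u -> hess u v (w1 + w2) = hess u v w1 + hess u v w2.
Proof.
move=> Uu; rewrite /hess /nabla_along derive_coord_fieldDr// /coord_field mulmxDl.
by rewrite christoffel_formDr addrACA.
Qed.

Lemma hessZr v a w u : U u -> hess u v (a *: w) = a *: hess u v w.
Proof.
move=> Uu; rewrite /hess /nabla_along derive_coord_fieldZr// /coord_field -scalemxAl.
by rewrite christoffel_formZr scalerDr.
Qed.

Variable u : 'rV[R]_n.
Hypothesis Uu : U u.
Hypothesis Gd : differentiable G (psi u).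
Hypothesis Gsym : \forall y \near psi u, (G y)^T = G y.

(** Torsion-freeness: second derivatives of [psi] commute and the Christoffel symbols are symmetric
    in their lower indices. *)
Lemma hessC v w : hess u v w = hess u w v.
Proof.
rewrite /hess /nabla_along derive_coord_fieldC//; congr (_ + _).
exact: christoffel_formC.
Qed.

Lemma hessDl v1 v2 w : hess u (v1 + v2) w = hess u v1 w + hess u v2 w.
Proof. by rewrite !(hessC _ w) hessDr. Qed.

Lemma hessZl a v w : hess u (a *: v) w = a *: hess u v w.
Proof. by rewrite !(hessC _ w) hessZr. Qed.

End CoordinateFields.

(** * Orthonormal frames and projections *)

Section OrthonormalFrames.
Variable R : realType.

(** Gram-Schmidt by induction on the dimension: split off the first basis vector and recurse on the
    Schur complement of its entry. *)
Lemma orthonormal_frame_exists n (G : 'M[R]_n) : G^T = G -> posdef G ->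
  exists E : 'M[R]_n, E *m G *m E^T = 1%:M.
Proof.
elim: n G => [|n IH] G Gs Gp; first by exists 0; apply/matrixP => -[].
move: G Gs Gp; rewrite -[n.+1]/(1 + n)%N => G.
rewrite -(submxK G); set P := ulsubmx G; set q := ursubmx G.
set q' := dlsubmx G; set S := drsubmx G => Gs Gp.
move: Gs; rewrite tr_block_mx => /eq_block_mx[_ _ q'E Ss].
have {}q'E : q' = q^T by rewrite -q'E.
rewrite {}q'E in Gp *.
pose p := P 0 0.
have PE : P = p%:M by rewrite [LHS]mx11_scalar.
rewrite PE in Gp *.
have p0 : 0 < p.
  have := Gp (row_mx 1%:M 0); rewrite /dotg tr_row_mx mul_row_block mul_row_col.
  rewrite !mul0mx !addr0 trmx0 mulmx0 addr0 trmx1 mulmx1 mul1mx mxE eqxx; apply.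
  apply/eqP => /(congr1 (fun M : 'rV_(1 + n) => lsubmx M 0 0)); rewrite row_mxKl !mxE.
  by apply/eqP; exact: oner_neq0.
have pn0 : p != 0 by rewrite gt_eqF.
(* The Schur complement, which is the form induced on the orthogonal complement of the first basis
   vector. *)
pose S' := S - p^-1 *: (q^T *m q).
have S's : S'^T = S' by rewrite /S' linearB/= linearZ/= Ss trmx_mul trmxK.
have [E ES] : exists E : 'M[R]_n, E *m S' *m E^T = 1%:M.
  apply: IH => // w w0.
  (* This lift of [w] is orthogonal to the first basis vector, so the value of the form on it is
     that of [S'] on [w]. *)
  have := Gp (row_mx (- p^-1 *: (w *m q^T)) w).
  rewrite /dotg tr_row_mx mul_row_block mul_row_col => H.
  apply: (lt_le_trans (H _)); last first.
    rewrite /S' mul_mx_scalar scalerA mulrN mulfV// scaleN1r addNr mul0mx add0r.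
    by rewrite addrC mulmxBr -scalemxAr -scalemxAl mulmxA scaleNr.
  apply: contra_neq w0 => /(congr1 rsubmx); rewrite row_mxKr => ->.
  by apply/rowP => j; rewrite !mxE.
(* First row: the normalized first basis vector. The other rows are those of [E], lifted
   orthogonally to it. *)
exists (block_mx (Num.sqrt p)^-1%:M 0 (- p^-1 *: (E *m q^T)) E).
have sp : Num.sqrt p * Num.sqrt p = p by rewrite -expr2 sqr_sqrtr// ltW.
have sp0 : Num.sqrt p != 0 by rewrite sqrtr_eq0 -ltNge.
rewrite tr_block_mx !mulmx_block (scalar_mx_block 1 n).
rewrite !mul0mx !addr0 trmx0 !mulmx0 !addr0.
have E1 : - p^-1 *: (E *m q^T) *m p%:M + E *m q^T = 0.
  by rewrite mul_mx_scalar scalerA mulrN mulfV// scaleN1r addNr.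
have E2 : - p^-1 *: (E *m q^T) *m q + E *m S = E *m S'.
  by rewrite /S' mulmxBr -scalemxAr -scalemxAl mulmxA addrC scaleNr.
rewrite E1 E2 !mul0mx add0r ES tr_scalar_mx -!scalar_mxM linearZ/= trmx_mul trmxK.
congr block_mx; first by congr (_%:M); rewrite -[X in _ * X * _]sp mulKf ?mulfV.
rewrite !mul_scalar_mx scalerA -scalemxAl -scalerDl.
rewrite -mulrA mulrN mulfV// mulrN1 addNr scale0r //.
Qed.

Lemma frame_unit n (G E : 'M[R]_n) : E *m G *m E^T = 1%:M -> E \in unitmx.
Proof. by rewrite -mulmxA => /mulmx1_unit[]. Qed.

(** This is why traces of bilinear maps over an orthonormal frame depend on [G] only. *)
Lemma frame_gram n (G E : 'M[R]_n) : E *m G *m E^T = 1%:M -> E^T *m E = invmx G.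
Proof.
rewrite -mulmxA => /mulmx1C E1.
have Gu : G \in unitmx by have := E1; rewrite -mulmxA => /mulmx1_unit[].
by rewrite -[LHS](mulKmx Gu) [G *m _]mulmxA E1 mulmx1.
Qed.

Lemma frame_row n (G E : 'M[R]_n) i j : E *m G *m E^T = 1%:M ->
  dotg G (row i E) (row j E) = (i == j)%:R.
Proof.
by move=> EG; rewrite !rowE -dotg_congr EG dotg_delta mxE.
Qed.

Lemma onframeP n (G : 'M[R]_n) : G^T = G -> posdef G ->
  onframe G *m G *m (onframe G)^T = 1%:M.
Proof.
move=> Gs Gp; rewrite /onframe.
have [E EG] := orthonormal_frame_exists Gs Gp.
by case: xgetP => [E' _ //|] /(_ E).
Qed.

(** Bilinearity encoded as the expansion in the standard basis, the form in which frame sums are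
    rewritten. *)
Definition bilin n (W : lmodType R) (h : 'rV[R]_n -> 'rV[R]_n -> W) :=
  forall v w, h v w = \sum_i \sum_j (v 0 i * w 0 j) *: h (delta_mx 0 i) (delta_mx 0 j).

Lemma bilin_intro n (W : lmodType R) (h : 'rV[R]_n -> 'rV[R]_n -> W) :
  (forall v v' w, h (v + v') w = h v w + h v' w) ->
  (forall a v w, h (a *: v) w = a *: h v w) ->
  (forall v w w', h v (w + w') = h v w + h v w') ->
  (forall a v w, h v (a *: w) = a *: h v w) -> bilin h.
Proof.
move=> Dl Zl Dr Zr v w; have h0l w' : h 0 w' = 0.
  by have := Zl 0 0 w'; rewrite !scale0r.
have h0r w' : h w' 0 = 0 by have := Zr 0 w' 0; rewrite !scale0r.
rewrite [v in LHS]row_sum_delta (big_morph (h^~ w) (fun v v' => Dl v v' w) (h0l w)).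
apply: eq_bigr => i _; rewrite Zl [w in LHS]row_sum_delta.
rewrite (big_morph (h _) (Dr _) (h0r _)) scaler_sumr; apply: eq_bigr => j _.
by rewrite Zr scalerA.
Qed.

Lemma bilin_frame_sum n (W : lmodType R) (h : 'rV[R]_n -> 'rV[R]_n -> W) (E : 'M[R]_n) :
  bilin h -> \sum_i h (row i E) (row i E) =
  \sum_k \sum_l (E^T *m E) k l *: h (delta_mx 0 k) (delta_mx 0 l).
Proof.
move=> hb; under eq_bigr do rewrite hb.
rewrite exchange_big; apply: eq_bigr => k _; rewrite exchange_big.
apply: eq_bigr => l _; rewrite mxE scaler_suml; apply: eq_bigr => i _.
by rewrite !mxE.
Qed.

Lemma bilin_frame_sum_eq n (W : lmodType R) (h : 'rV[R]_n -> 'rV[R]_n -> W)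
    (G E E' : 'M[R]_n) :
  bilin h -> E *m G *m E^T = 1%:M -> E' *m G *m E'^T = 1%:M ->
  \sum_i h (row i E) (row i E) = \sum_i h (row i E') (row i E').
Proof.
by move=> hb EG E'G; rewrite !bilin_frame_sum// (frame_gram EG) (frame_gram E'G).
Qed.

End OrthonormalFrames.

Section Tangential.
Variables (R : realType) (n m : nat) (G : 'M[R]_m) (A : 'M[R]_(n, m)).
Hypothesis AGA : A *m G *m A^T \in unitmx.

Lemma normal_orth v : normal G A v *m G *m A^T = 0.
Proof.
rewrite /normal /tangential !mulmxBl -(mulmxA _ A G) -(mulmxA _ (A *m G)) mulmxKV//.
by rewrite subrr.
Qed.

Lemma dotg_normal v w : dotg G (normal G A v) (w *m A) = 0.
Proof. by rewrite /dotg trmx_mul mulmxA normal_orth mul0mx mxE. Qed.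

Lemma rows_orth (v : 'rV[R]_m) : (forall w, dotg G v (w *m A) = 0) -> v *m G *m A^T = 0.
Proof.
move=> vA; apply/rowP => j; have := vA (delta_mx 0 j).
by rewrite /dotg trmx_mul mulmxA trmx_delta -colE !mxE.
Qed.

Lemma tangential_uniq v t : (v - t *m A) *m G *m A^T = 0 -> tangential G A v = t *m A.
Proof.
move=> /eqP; rewrite !mulmxBl subr_eq0 => /eqP E; rewrite /tangential E.
by rewrite -(mulmxA t A G) -(mulmxA t) mulmxK.
Qed.

Lemma normalD v w : normal G A (v + w) = normal G A v + normal G A w.
Proof. by rewrite /normal /tangential !mulmxDl opprD addrACA. Qed.

Lemma normalZ a v : normal G A (a *: v) = a *: normal G A v.
Proof. by rewrite /normal /tangential -!scalemxAl scalerBr. Qed.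

End Tangential.

(** * Pointwise estimate of the mixed part of the second fundamental form *)

Section Traces.
Variables (R : realType) (n : nat).
Implicit Types M N : 'M[R]_n.

Lemma mxtrace_mul_tr M N : \tr (M *m N^T) = \sum_i \sum_j M i j * N i j.
Proof.
rewrite /mxtrace; apply: eq_bigr => i _; rewrite mxE.
by apply: eq_bigr => j _; rewrite mxE.
Qed.

(** With [H] the inverse of a metric, this trace is the induced inner product of two bilinear forms;
    the lemma is its symmetry. *)
Lemma mxtrace_twist_sym M N (H : 'M[R]_n) : H^T = H ->
  \tr (M *m H *m N^T *m H) = \tr (N *m H *m M^T *m H).
Proof.
move=> Hs; rewrite -mxtrace_tr !trmx_mul trmxK Hs !mulmxA.
by rewrite -[X in \tr X]mulmxA -[X in \tr X]mulmxA mxtrace_mulC !mulmxA.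
Qed.

Lemma mxtrace_sqr_ge0 M : 0 <= \tr (M *m M^T).
Proof.
by rewrite mxtrace_mul_tr !sumr_ge0// => i _; rewrite sumr_ge0// => j _; rewrite -expr2 sqr_ge0.
Qed.

Lemma mxtrace_skew M : M^T = - M -> \tr M = 0.
Proof. by move=> Ms; have := mxtrace_tr M; rewrite Ms raddfN/=; lra. Qed.

(* The difference of [t *: M - 3^-1 *: N] and [(t / 3) *: M] is orthogonal to
   [M] for the trace form. *)
Lemma mxtrace_skew_bound M N (t : R) :
  \tr (N *m M^T) = 2 * t * \tr (M *m M^T) ->
  \tr ((t *: M - 3^-1 *: N) *m (t *: M - 3^-1 *: N)^T) >= 9^-1 * t ^+ 2 * \tr (M *m M^T).
Proof.
move=> NM.
have MN : \tr (M *m N^T) = 2 * t * \tr (M *m M^T).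
  by rewrite -NM -mxtrace_tr trmx_mul trmxK.
have sqrE x y : \tr ((x *: M - y *: N) *m (x *: M - y *: N)^T) =
    x ^+ 2 * \tr (M *m M^T) - 2 * (x * y) * (2 * t * \tr (M *m M^T)) + y ^+ 2 * \tr (N *m N^T).
  rewrite [(_ - _)^T]raddfB/= [(x *: M)^T]linearZ/= [(y *: N)^T]linearZ/=.
  rewrite mulmxBl !mulmxBr -!scalemxAl -!scalemxAr !scalerA.
  by rewrite !raddfB/= !mxtraceZ NM MN; ring.
have := mxtrace_sqr_ge0 ((2 / 3 * t) *: M - 3^-1 *: N); rewrite !sqrE => H.
by rewrite -subr_ge0; apply: le_trans H _; rewrite le_eqVlt; apply/orP; left; apply/eqP; field.
Qed.

End Traces.

Section Bessel.
Variables (R : realType) (m n : nat) (G : 'M[R]_m).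
Hypotheses (Gs : G^T = G) (Gp : posdef G).

Lemma bessel (F : 'I_n -> 'rV[R]_m) (s : R) (h : 'rV[R]_m) : 0 < s ->
  (forall k l, dotg G (F k) (F l) = s * (k == l)%:R) ->
  \sum_k dotg G h (F k) ^+ 2 <= s * dotg G h h.
Proof.
move=> s0 FF; set S := \sum_k _.
pose p := \sum_k dotg G h (F k) *: F k.
have hp : dotg G h p = S.
  by rewrite dotg_sumr; apply: eq_bigr => k _; rewrite dotgZr expr2.
have pp : dotg G p p = s * S.
  rewrite dotg_suml mulr_sumr; apply: eq_bigr => k _.
  rewrite dotgZl dotg_sumr (bigD1 k)//= big1 ?addr0 => [|l lk].
    by rewrite dotgZr FF eqxx mulr1; ring.
  by rewrite dotgZr FF eq_sym (negbTE lk) !mulr0.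
(* The squared norm of [s *: h - p] is [s] times the difference of the two sides of the
   inequality. *)
have := posdef_ge0 (s *: h - p) Gp.
rewrite !dotgBl !dotgBr !dotgZl !dotgZr (dotgC p h Gs) hp pp => H.
rewrite -(ler_pM2l s0) -subr_ge0; apply: le_trans H _.
by rewrite le_eqVlt; apply/orP; left; apply/eqP; ring.
Qed.

End Bessel.

Section MixedEstimate.
Variables (R : realType) (a b m : nat) (G J : 'M[R]_m) (A : 'M[R]_(a + b, m)).
Variables (G1 : 'M[R]_a) (G2 : 'M[R]_b).
Hypotheses (Gs : G^T = G) (Gp : posdef G).
Hypothesis AGA : A *m G *m A^T = block_mx G1 0 0 G2.
Hypotheses (G2u : G2 \in unitmx) (G2s : G2^T = G2).
Hypothesis JG : forall v w, dotg G (v *m J) (w *m J) = dotg G v w.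

Local Notation inX x := (row_mx x 0 : 'rV[R]_(a + b)).
Local Notation inZ z := (row_mx 0 z : 'rV[R]_(a + b)).

Lemma dotg_block v1 v2 w1 w2 : dotg (block_mx G1 0 0 G2) (row_mx v1 v2) (row_mx w1 w2) =
  dotg G1 v1 w1 + dotg G2 v2 w2.
Proof.
by rewrite /dotg mul_row_block !mulmx0 add0r addr0 tr_row_mx mul_row_col mxE.
Qed.

Lemma dotg_ZZ z w : dotg G (inZ z *m A) (inZ w *m A) = dotg G2 z w.
Proof. by rewrite -dotg_congr AGA dotg_block dotg0l add0r. Qed.

Variables (om : 'M[R]_b) (s2 c2 : R).
Hypothesis omE : forall z w, dotg G (inZ z *m A *m J) (inZ w *m A) = dotg om z w.
Hypothesis slant : om *m invmx G2 *m om^T = c2 *: G2.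
Hypotheses (s2_gt0 : 0 < s2) (s2E : s2 = 1 - c2).

(** The matrix [om *m invmx G2] gives the component of JZ tangent to the second factor, which is
    subtracted here. *)
Definition slant_normal (z : 'rV[R]_b) : 'rV[R]_m :=
  inZ z *m A *m J - inZ (z *m om *m invmx G2) *m A.

Lemma slant_normal_orth z w : dotg G (slant_normal z) (inZ w *m A) = 0.
Proof.
rewrite /slant_normal dotgBl omE dotg_ZZ /dotg mulmxKV// subrr //.
Qed.

(** Pythagoras in polarized form: J preserves inner products, and [slant] says that the tangential
    parts have inner product [c2 * dotg G2 z w]. *)
Lemma dotg_slant_normal z w : dotg G (slant_normal z) (slant_normal w) = s2 * dotg G2 z w.
Proof.
rewrite {2}/slant_normal dotgBr slant_normal_orth subr0 /slant_normal dotgBl JG dotg_ZZ.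
rewrite (dotgC (_ *m A) _ Gs) omE s2E mulrBl mul1r; congr (_ - _).
rewrite -dotgZm -slant (dotgC z w); last first.
  by rewrite !trmx_mul trmxK trmx_inv G2s mulmxA.
by rewrite /dotg !trmx_mul trmx_inv G2s !mulmxA.
Qed.

Variables (h : 'rV[R]_(a + b) -> 'rV[R]_(a + b) -> 'rV[R]_m) (ell : 'cV[R]_a) (C : 'M[R]_a).
Variable dom : 'rV[R]_a -> 'M[R]_b.
Local Notation lam x := ((x *m ell) 0 0).
Hypothesis h_normal : forall v w z, dotg G (h v w) (z *m A) = 0.
Hypothesis CG : C *m G1 *m C^T = G1.
Hypothesis om_skew : om^T = - om.
Hypothesis dom_skew : forall x, (dom x)^T = - dom x.
Hypothesis dom_om : forall x, \tr (dom x *m invmx G2 *m om^T *m invmx G2) = 2 * lam x * (c2 * b%:R).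
Hypothesis h_mixed : forall x z w, dotg G (h (inX x) (inZ z)) (inZ w *m A *m J) =
  - lam (x *m C) * dotg G2 z w + dotg (lam x *: om - 3^-1 *: dom x) z w.

(** Here [ell] stands for d ln f, [C] for J on the first factor, and [s2], [c2] for the squared sine
    and cosine of the slant angle. The estimate for one [x] involves both X ln f and JX ln f;
    summation over a frame merges them because [C] is an isometry of [G1]. *)
Lemma mixed_estimate (E1 : 'M[R]_a) (E2 : 'M[R]_b) :
  E1 *m G1 *m E1^T = 1%:M -> E2 *m G2 *m E2^T = 1%:M ->
  b%:R * (s2^-1 + 9^-1 * (c2 / s2)) * \sum_i lam (row i E1) ^+ 2 <=
  \sum_i \sum_j dotg G (h (inX (row i E1)) (inZ (row j E2)))
                       (h (inX (row i E1)) (inZ (row j E2))).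
Proof.
move=> E1G E2G; have E2E := frame_gram E2G.
have row_est x : b%:R * lam (x *m C) ^+ 2 + 9^-1 * c2 * b%:R * lam x ^+ 2 <=
    s2 * \sum_j dotg G (h (inX x) (inZ (row j E2))) (h (inX x) (inZ (row j E2))).
  pose eta := E2 *m (lam x *: om - 3^-1 *: dom x) *m E2^T.
  (* In the frame [E2] the inner product of forms relative to [G2] becomes the plain sum of products
     of entries. *)
  have frame_tr M N : \tr ((E2 *m M *m E2^T) *m (E2 *m N *m E2^T)^T) =
      \tr (M *m invmx G2 *m N^T *m invmx G2).
    rewrite -E2E !trmx_mul trmxK !mulmxA.
    by rewrite [RHS]mxtrace_mulC !mulmxA.
  have omE2 : \tr ((E2 *m om *m E2^T) *m (E2 *m om *m E2^T)^T) = c2 * b%:R.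
    by rewrite frame_tr slant -scalemxAl mxtraceZ mulmxV// mxtrace1.
  have domE2 : \tr ((E2 *m dom x *m E2^T) *m (E2 *m om *m E2^T)^T) =
      2 * lam x * (c2 * b%:R).
    by rewrite frame_tr dom_om.
  have eta_sqr : 9^-1 * c2 * b%:R * lam x ^+ 2 <= \tr (eta *m eta^T).
    have -> : eta = lam x *: (E2 *m om *m E2^T) - 3^-1 *: (E2 *m dom x *m E2^T).
      by rewrite /eta mulmxBr mulmxBl -!scalemxAr -!scalemxAl.
    apply: le_trans (mxtrace_skew_bound _); last by rewrite domE2 omE2.
    by rewrite omE2 le_eqVlt; apply/orP; left; apply/eqP; ring.
  (* The cross term between the multiple of the identity and [eta] is a multiple of this trace, so
     the two squares add up. *)
  have eta_tr : \sum_j eta j j = 0.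
    have Xs : (lam x *: om - 3^-1 *: dom x)^T = - (lam x *: om - 3^-1 *: dom x).
      rewrite [LHS]raddfB/= [(lam x *: om)^T]linearZ/= [(3^-1 *: _)^T]linearZ/=.
      by rewrite om_skew dom_skew !scalerN opprB opprK addrC.
    by apply: mxtrace_skew; rewrite !trmx_mul trmxK Xs mulmxA mulmxN mulNmx.
  apply: (@le_trans _ _ (\sum_j \sum_k (- lam (x *m C) * (j == k)%:R + eta j k) ^+ 2)).
    have -> : \sum_j \sum_k (- lam (x *m C) * (j == k)%:R + eta j k) ^+ 2 =
        b%:R * lam (x *m C) ^+ 2 + \tr (eta *m eta^T).
      rewrite mxtrace_mul_tr.
      transitivity (\sum_j (lam (x *m C) ^+ 2 - 2 * lam (x *m C) * eta j j +
          \sum_k eta j k * eta j k)).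
        apply: eq_bigr => j _; rewrite (bigD1 j)//= [in RHS](bigD1 j)//= eqxx.
        rewrite addrA; congr (_ + _); first by rewrite mulr1; ring.
        by apply: eq_bigr => k kj; rewrite eq_sym (negbTE kj) mulr0 add0r expr2.
      rewrite big_split/= sumrB -[X in _ - X + _]mulr_sumr eta_tr mulr0 subr0 sumr_const card_ord.
      by rewrite mulr_natl.
    by rewrite lerD2l.
  rewrite mulr_sumr; apply: ler_sum => j _.
  pose F k := slant_normal (row k E2).
  have FF k l : dotg G (F k) (F l) = s2 * (k == l)%:R.
    by rewrite dotg_slant_normal (frame_row _ _ E2G).
  apply: le_trans (bessel Gs Gp (h (inX x) (inZ (row j E2))) s2_gt0 FF).
  apply: ler_sum => k _; rewrite le_eqVlt; apply/orP; left; apply/eqP; congr (_ ^+ 2).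
  rewrite /F /slant_normal dotgBr h_normal subr0 h_mixed (frame_row _ _ E2G).
  by congr (_ + _); rewrite !rowE -dotg_congr dotg_delta.
(* The rows of [E1 *m C] form another orthonormal frame of [G1], and the sum of squares does not
   depend on the frame. *)
have lamC : \sum_i lam (row i E1 *m C) ^+ 2 = \sum_i lam (row i E1) ^+ 2.
  have bl : bilin (fun v w : 'rV[R]_a => lam v * lam w : R^o).
    have lamD v w : lam (v + w) = lam v + lam w by rewrite mulmxDl mxE.
    have lamZ t v : lam (t *: v) = t * lam v by rewrite -scalemxAl mxE.
    apply: bilin_intro => [v v' w|t v w|v w w'|t v w].
    - by rewrite lamD mulrDl.
    - by rewrite lamZ -mulrA.
    - by rewrite lamD mulrDr.
    - by rewrite lamZ mulrCA.
  have E1C : (E1 *m C) *m G1 *m (E1 *m C)^T = 1%:M.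
    by rewrite trmx_mul !mulmxA -(mulmxA E1) -(mulmxA E1) CG.
  have := bilin_frame_sum_eq bl E1G E1C; rewrite /= => E.
  transitivity (\sum_i lam (row i (E1 *m C)) * lam (row i (E1 *m C))).
    by apply: eq_bigr => i _; rewrite row_mul expr2.
  by rewrite -E; apply: eq_bigr => i _; rewrite expr2.
rewrite -(ler_pM2l s2_gt0) [leRHS]mulr_sumr.
apply: le_trans; last by apply: ler_sum => i _; exact: row_est.
rewrite big_split/= -!mulr_sumr lamC le_eqVlt; apply/orP; left; apply/eqP; field.
by rewrite gt_eqF.
Qed.

End MixedEstimate.

Section BlockFrames.
Variables (R : realType) (a b m : nat).
Local Notation inX x := (row_mx x 0 : 'rV[R]_(a + b)).
Local Notation inZ z := (row_mx 0 z : 'rV[R]_(a + b)).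

Lemma row_block_l (E1 : 'M[R]_a) (E2 : 'M[R]_b) i :
  row (lshift b i) (block_mx E1 0 0 E2) = inX (row i E1).
Proof. by rewrite rowKu row_row_mx row0. Qed.

Lemma row_block_r (E1 : 'M[R]_a) (E2 : 'M[R]_b) i :
  row (rshift a i) (block_mx E1 0 0 E2) = inZ (row i E2).
Proof. by rewrite rowKd row_row_mx row0. Qed.

Lemma block_frame (G1 E1 : 'M[R]_a) (G2 E2 : 'M[R]_b) :
  E1 *m G1 *m E1^T = 1%:M -> E2 *m G2 *m E2^T = 1%:M ->
  block_mx E1 0 0 E2 *m block_mx G1 0 0 G2 *m (block_mx E1 0 0 E2)^T = 1%:M.
Proof.
move=> E1G E2G; rewrite tr_block_mx !mulmx_block !trmx0 !(mul0mx, mulmx0, addr0, add0r).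
by rewrite E1G E2G -scalar_mx_block.
Qed.

Lemma sum_block_frame (W : nmodType) (E1 : 'M[R]_a) (E2 : 'M[R]_b) (q : 'rV[R]_(a + b) -> W) :
  \sum_i q (row i (block_mx E1 0 0 E2)) =
  \sum_i q (inX (row i E1)) + \sum_i q (inZ (row i E2)).
Proof.
rewrite big_split_ord/=; congr (_ + _); apply: eq_bigr => i _.
  by rewrite row_block_l.
by rewrite row_block_r.
Qed.

Lemma posdef_block (G1 : 'M[R]_a) (G2 : 'M[R]_b) :
  posdef G1 -> posdef G2 -> posdef (block_mx G1 0 0 G2).
Proof.
move=> G1p G2p v; rewrite -(hsubmxK v) dotg_block => v0.
have [l0|/G1p l0] := eqVneq (lsubmx v) 0; last by rewrite ltr_wpDr// posdef_ge0.
rewrite ltr_wpDl ?posdef_ge0// G2p//.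
by apply: contra_neq v0 => ->; rewrite l0 row_mx0.
Qed.

Lemma parseval n (B E : 'M[R]_n) (v : 'rV[R]_n) : E *m B *m E^T = 1%:M ->
  \sum_i dotg B v (row i E) ^+ 2 = dotg B v v.
Proof.
move=> EB; have Bu : B \in unitmx.
  by move: EB; rewrite -mulmxA => /mulmx1C; rewrite -mulmxA => /mulmx1_unit[].
have bl : bilin (fun v1 v2 : 'rV[R]_n => dotg B v v1 * dotg B v v2 : R^o).
  apply: bilin_intro => [v1 v2 w|t v1 w|v1 w1 w2|t v1 w].
  - by rewrite dotgDr mulrDl.
  - by rewrite dotgZr -mulrA.
  - by rewrite dotgDr mulrDr.
  - by rewrite dotgZr mulrCA.
have := bilin_frame_sum E bl; rewrite (frame_gram EB) => E'.
transitivity (\sum_i dotg B v (row i E) * dotg B v (row i E)).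
  by apply: eq_bigr => i _; rewrite expr2.
rewrite E' /=.
transitivity ((v *m B *m invmx B *m (v *m B)^T) 0 0).
  transitivity (dotg (invmx B) (v *m B) (v *m B)); last by [].
  rewrite dotg_sumE; apply: eq_bigr => k _; apply: eq_bigr => l _.
  rewrite /dotg !trmx_delta -!colE !mxE /GRing.scale/=; ring.
rewrite mulmxK// trmx_mul mulmxA.
have -> : dotg B v v = (v *m B *m v^T)^T 0 0 by rewrite mxE.
by rewrite !trmx_mul trmxK mulmxA.
Qed.

Lemma bilin_zero n (W : lmodType R) (h : 'rV[R]_n -> 'rV[R]_n -> W) (E : 'M[R]_n) :
  (forall v v' w, h (v + v') w = h v w + h v' w) ->
  (forall t v w, h (t *: v) w = t *: h v w) ->
  (forall v w w', h v (w + w') = h v w + h v w') ->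
  (forall t v w, h v (t *: w) = t *: h v w) -> E \in unitmx ->
  (forall i j, h (row i E) (row j E) = 0) -> forall v w, h v w = 0.
Proof.
move=> Dl Zl Dr Zr Eu h0 v w.
have bh : bilin (fun v w => h (v *m E) (w *m E)).
  apply: bilin_intro => *.
  - by rewrite mulmxDl Dl.
  - by rewrite -scalemxAl Zl.
  - by rewrite mulmxDl Dr.
  - by rewrite -scalemxAl Zr.
rewrite -(mulmxKV Eu v) -(mulmxKV Eu w) bh big1// => i _; rewrite big1// => j _.
by rewrite -!rowE h0 scaler0.
Qed.

Variables (G : 'M[R]_m) (h : 'rV[R]_(a + b) -> 'rV[R]_(a + b) -> 'rV[R]_m).
Hypothesis Gp : posdef G.
Hypothesis hDl : forall v v' w, h (v + v') w = h v w + h v' w.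
Hypothesis hZl : forall t v w, h (t *: v) w = t *: h v w.
Hypothesis hC : forall v w, h v w = h w v.

(** The frame is changed in one argument at a time, each change being the frame independence of a
    trace. *)
Lemma frame_sqnorm_eq (B E E' : 'M[R]_(a + b)) :
  E *m B *m E^T = 1%:M -> E' *m B *m E'^T = 1%:M ->
  \sum_i \sum_j dotg G (h (row i E) (row j E)) (h (row i E) (row j E)) =
  \sum_i \sum_j dotg G (h (row i E') (row j E')) (h (row i E') (row j E')).
Proof.
move=> EB E'B.
have bl w : bilin (fun v v' => dotg G (h v w) (h v' w) : R^o).
  apply: bilin_intro => *.
  - by rewrite hDl dotgDl.
  - by rewrite hZl dotgZl.
  - by rewrite hDl dotgDr.
  - by rewrite hZl dotgZr.
rewrite exchange_big/=.
transitivity (\sum_j \sum_i dotg G (h (row i E') (row j E)) (h (row i E') (row j E))).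
  by apply: eq_bigr => j _; exact: (bilin_frame_sum_eq (bl (row j E)) EB E'B).
rewrite exchange_big/=; apply: eq_bigr => i _.
under eq_bigr do rewrite hC; under [RHS]eq_bigr do rewrite hC.
exact: (bilin_frame_sum_eq (bl (row i E')) EB E'B).
Qed.

Variables (G1 E1 : 'M[R]_a) (G2 E2 : 'M[R]_b) (E : 'M[R]_(a + b)).
Hypothesis E1G : E1 *m G1 *m E1^T = 1%:M.
Hypothesis E2G : E2 *m G2 *m E2^T = 1%:M.
Hypothesis EG : E *m block_mx G1 0 0 G2 *m E^T = 1%:M.

Let N v w := dotg G (h v w) (h v w).

Lemma frame_sqnorm_split :
  \sum_i \sum_j dotg G (h (row i E) (row j E)) (h (row i E) (row j E)) =
  \sum_i \sum_j N (inX (row i E1)) (inX (row j E1)) +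
  2 * (\sum_i \sum_j N (inX (row i E1)) (inZ (row j E2))) +
  \sum_i \sum_j N (inZ (row i E2)) (inZ (row j E2)).
Proof.
rewrite (frame_sqnorm_eq EG (block_frame E1G E2G)).
rewrite (sum_block_frame E1 E2 (fun v => \sum_j N v (row j (block_mx E1 0 0 E2)))).
under eq_bigr do rewrite (sum_block_frame E1 E2 (N _)).
under [X in _ + X]eq_bigr do rewrite (sum_block_frame E1 E2 (N _)).
rewrite !big_split/=.
have -> : \sum_i \sum_j N (inZ (row i E2)) (inX (row j E1)) =
    \sum_i \sum_j N (inX (row i E1)) (inZ (row j E2)).
  rewrite exchange_big/=; apply: eq_bigr => i _; apply: eq_bigr => j _.
  by rewrite /N hC.
ring.
Qed.

Lemma frame_sqnorm_split_ge :
  2 * (\sum_i \sum_j N (inX (row i E1)) (inZ (row j E2))) <=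
  \sum_i \sum_j dotg G (h (row i E) (row j E)) (h (row i E) (row j E)).
Proof.
rewrite frame_sqnorm_split -addrA addrCA lerDl addr_ge0//;
  by do 2!(apply: sumr_ge0 => ? _); exact: posdef_ge0.
Qed.

(** The two unmixed sums have nonnegative terms and total at most zero, so [h] vanishes on pairs
    from the same frame, hence on each factor by bilinearity. *)
Lemma frame_sqnorm_split_eq :
  \sum_i \sum_j dotg G (h (row i E) (row j E)) (h (row i E) (row j E)) <=
  2 * (\sum_i \sum_j N (inX (row i E1)) (inZ (row j E2))) ->
  (forall x y, h (inX x) (inX y) = 0) /\ (forall z w, h (inZ z) (inZ w) = 0).
Proof.
have hDr v w w' : h v (w + w') = h v w + h v w' by rewrite !(hC v) hDl.
have hZr t v w : h v (t *: w) = t *: h v w by rewrite !(hC v) hZl.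
have N0 v w : 0 <= N v w by exact: posdef_ge0.
rewrite frame_sqnorm_split => le0.
have sum0 n (r : 'I_n -> 'rV[R]_(a + b)) : \sum_i \sum_j N (r i) (r j) <= 0 ->
    forall i j, h (r i) (r j) = 0.
  move=> H i j; apply: (posdef_eq0 Gp); apply/eqP; rewrite eq_le N0 andbT.
  apply: le_trans H; rewrite (bigD1 i)//= (bigD1 j)//= -addrA lerDl.
  by rewrite addr_ge0// sumr_ge0// => k _; rewrite // sumr_ge0.
have S1 : 0 <= \sum_i \sum_j N (inX (row i E1)) (inX (row j E1)).
  by do 2!(apply: sumr_ge0 => ? _).
have S2 : 0 <= \sum_i \sum_j N (inZ (row i E2)) (inZ (row j E2)).
  by do 2!(apply: sumr_ge0 => ? _).
have inXD (x y : 'rV[R]_a) : inX (x + y) = inX x + inX y by rewrite add_row_mx addr0.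
have inXZ t (x : 'rV[R]_a) : inX (t *: x) = t *: inX x by rewrite scale_row_mx scaler0.
have inZD (x y : 'rV[R]_b) : inZ (x + y) = inZ x + inZ y by rewrite add_row_mx addr0.
have inZZ t (x : 'rV[R]_b) : inZ (t *: x) = t *: inZ x by rewrite scale_row_mx scaler0.
split.
  apply: (bilin_zero (h := fun x y => h (inX x) (inX y)) _ _ _ _ (frame_unit E1G)) => *;
    rewrite ?inXD ?inXZ ?hDl ?hDr ?hZl ?hZr//.
  by apply: (sum0 _ (fun i => inX (row i E1))); lra.
apply: (bilin_zero (h := fun x y => h (inZ x) (inZ y)) _ _ _ _ (frame_unit E2G)) => *;
  rewrite ?inZD ?inZZ ?hDl ?hDr ?hZl ?hZr//.
by apply: (sum0 _ (fun i => inZ (row i E2))); lra.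
Qed.

End BlockFrames.

(** * The immersion of a warped product in local coordinates *)

Section WarpedImmersion.
Variables (R : realType) (a b m : nat) (U : set 'rV[R]_(a + b)) (Y : set 'rV[R]_m).
Variables (psi : 'rV[R]_(a + b) -> 'rV[R]_m) (G J : 'rV[R]_m -> 'M[R]_m).
Variables (g1 : 'rV[R]_a -> 'M[R]_a) (g2 : 'rV[R]_b -> 'M[R]_b) (F : 'rV[R]_a -> R).
Variable c2 : R.
Hypotheses (Uopen : open U) (Yopen : open Y).
Hypothesis psis : smooth_on U psi.
Hypothesis psiY : forall u, U u -> Y (psi u).
Hypothesis Gd : forall y, Y y -> differentiable G y.
Hypothesis Jd : forall y, Y y -> differentiable J y.
Hypothesis Gs : forall y, Y y -> (G y)^T = G y.
Hypothesis Gp : forall y, Y y -> posdef (G y).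
Hypothesis JJ : forall y, Y y -> J y *m J y = - 1%:M.
Hypothesis JG : forall y, Y y -> forall v w,
  dotg (G y) (v *m J y) (w *m J y) = dotg (G y) v w.
Hypothesis nk : forall y, Y y -> forall v, cov_acs G J y v v = 0.

Local Notation A u := (jacobian psi u).
Local Notation inX x := (row_mx x 0 : 'rV[R]_(a + b)).
Local Notation inZ z := (row_mx 0 z : 'rV[R]_(a + b)).
Local Notation x_ u := (lsubmx u : 'rV[R]_a).
Local Notation z_ u := (rsubmx u : 'rV[R]_b).

Hypothesis warped : forall u, U u ->
  A u *m G (psi u) *m (A u)^T = block_mx (g1 (x_ u)) 0 0 (F (x_ u) ^+ 2 *: g2 (z_ u)).
Hypothesis Fd : forall u, U u -> differentiable F (x_ u).
Hypothesis Fp : forall u, U u -> 0 < F (x_ u).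
Hypothesis g1s : forall u, U u -> (g1 (x_ u))^T = g1 (x_ u).
Hypothesis g1p : forall u, U u -> posdef (g1 (x_ u)).
Hypothesis g2s : forall u, U u -> (g2 (z_ u))^T = g2 (z_ u).
Hypothesis g2p : forall u, U u -> posdef (g2 (z_ u)).

Definition slant_form (u : 'rV[R]_(a + b)) : 'M[R]_b :=
  dsubmx (A u) *m J (psi u) *m G (psi u) *m (dsubmx (A u))^T.

Hypothesis holo : forall u, U u -> exists C : 'M[R]_a, forall x : 'rV[R]_a,
  inX x *m A u *m J (psi u) = inX (x *m C) *m A u.
Hypothesis slant : forall u, U u ->
  slant_form u *m invmx (F (x_ u) ^+ 2 *: g2 (z_ u)) *m (slant_form u)^T =
  c2 *: (F (x_ u) ^+ 2 *: g2 (z_ u)).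

Lemma near_domain (P : 'rV[R]_(a + b) -> Prop) u : U u ->
  (forall u', U u' -> P u') -> \near u, P u.
Proof.
by move=> Uu UP; apply: filterS (open_nbhs_nbhs (conj Uopen Uu)).
Qed.

Lemma near_codomain (P : 'rV[R]_m -> Prop) y : Y y ->
  (forall y', Y y' -> P y') -> \near y, P y.
Proof.
by move=> Yy YP; apply: filterS (open_nbhs_nbhs (conj Yopen Yy)).
Qed.

Lemma inZ_mul (z : 'rV[R]_b) u : inZ z *m A u = z *m dsubmx (A u).
Proof. by rewrite -[in LHS](vsubmxK (A u)) mul_row_col mul0mx add0r. Qed.

Lemma slant_formE u z w :
  dotg (G (psi u)) (inZ z *m A u *m J (psi u)) (inZ w *m A u) = dotg (slant_form u) z w.
Proof. by rewrite !inZ_mul /dotg /slant_form trmx_mul !mulmxA. Qed.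

(** J is an isometry whose inverse is -J. *)
Lemma acs_skew y : Y y -> J y *m G y = - (G y *m (J y)^T).
Proof.
move=> Yy; have E : J y *m G y *m (J y)^T = G y.
  by apply: dotg_inj => v w; rewrite dotg_congr JG.
by rewrite -[in LHS]E !mulmxA JJ// !mulNmx mul1mx.
Qed.

Lemma dotg_acsN u v w : U u ->
  dotg (G (psi u)) (v *m J (psi u)) w = - dotg (G (psi u)) v (w *m J (psi u)).
Proof.
move=> Uu; apply: dotg_acs; apply: near_codomain; first exact: psiY.
exact: acs_skew.
Qed.

Section AtPoint.
Variable u : 'rV[R]_(a + b).
Hypothesis Uu : U u.

Let Yu : Y (psi u) := psiY Uu.
Let psid : differentiable psi u := smooth_differentiable psis Uu.
Let nGs : \forall y \near psi u, (G y)^T = G y := near_codomain Yu Gs.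
Let Gu : G (psi u) \in unitmx := posdef_unit (Gp Yu).
Let H v w : 'rV[R]_m := hess psi G u v w.
Let AG := warped Uu.
Let dcf v w : derivable (coord_field psi w) u v := derivable_coord_field Uopen psis Uu.
Let F0 : F (x_ u) != 0. Proof. by rewrite gt_eqF// Fp. Qed.

(* X (ln f), for X tangent to the first factor. *)
Definition log_warp (x : 'rV[R]_a) : R := 'D_x F (x_ u) / F (x_ u).
Local Notation lam := log_warp.

Definition log_warp_col : 'cV[R]_a := \col_i (lam (delta_mx 0 i)).

Lemma log_warpE x : lam x = (x *m log_warp_col) 0 0.
Proof.
have E : 'D_x F (x_ u) = \sum_i x 0 i * 'D_(delta_mx 0 i) F (x_ u).
  exact: derive_row_sum (Fd Uu).
rewrite /log_warp_col /lam mxE E mulr_suml.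
by apply: eq_bigr => i _; rewrite mxE mulrA.
Qed.

Let K v w z := dotg (G (psi u)) (H v w) (z *m A u).
Let B u' v w := dotg (A u' *m G (psi u') *m (A u')^T) v w.

(** Koszul's formula for three coordinate fields, hence without bracket terms. The derivatives are
    arguments, so that each of the block computations below can be inserted directly. *)
Lemma koszul v w z (bvwz bwvz bzvw : R) :
  is_derive u v (fun u' => B u' w z) bvwz -> is_derive u w (fun u' => B u' v z) bwvz ->
  is_derive u z (fun u' => B u' v w) bzvw -> 2 * K v w z = bvwz + bwvz - bzvw.
Proof.
have dB v' w' z' : is_derive u v' (fun u' => B u' w' z') (K v' w' z' + K v' z' w').
  have d := is_derive_metric_along psid (Gd Yu) nGs Gu
    (@dcf v' w') (@dcf v' z').
  have E : (fun u' => B u' w' z') = fun u' =>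
      dotg (G (psi u')) (coord_field psi w' u') (coord_field psi z' u').
    by apply/funext => u'; rewrite /B dotg_congr.
  rewrite E; apply: (is_derive_eq d); congr (_ + _).
  by rewrite (dotgC _ _ (Gs Yu)).
have Kc v' w' z' : K v' w' z' = K w' v' z'.
  by rewrite /K /H (hessC Uopen psis Uu nGs).
move=> [_ <-] [_ <-] [_ <-].
have [_ ->] := dB v w z; have [_ ->] := dB w v z; have [_ ->] := dB z v w.
rewrite (Kc w v) (Kc z v) (Kc z w); ring.
Qed.

Lemma near_warped v1 v2 w1 w2 : \near u, dotg (g1 (x_ u)) v1 w1 +
  F (x_ u) ^+ 2 * dotg (g2 (z_ u)) v2 w2 = B u (row_mx v1 v2) (row_mx w1 w2).
Proof.
by apply: near_domain => // u' Uu'; rewrite /B warped// dotg_block dotgZm.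
Qed.

Let lsubZ z (t : R) : x_ (t *: inZ z + u) = x_ u.
Proof. by rewrite raddfD/= scale_row_mx row_mxKl scaler0 add0r. Qed.

Let rsubX x (t : R) : z_ (t *: inX x + u) = z_ u.
Proof. by rewrite raddfD/= scale_row_mx row_mxKr scaler0 add0r. Qed.

Lemma derive_metric_XZ v x z : is_derive u v (fun u' => B u' (inX x) (inZ z)) 0.
Proof.
apply: (near_eq_is_derive (near_warped x 0 0 z)).
rewrite (_ : (fun u => _) = cst 0); first exact: is_derive_cst.
by apply/funext => u'; rewrite dotg0l dotg0r mulr0 addr0.
Qed.

Lemma derive_metric_ZX v x z : is_derive u v (fun u' => B u' (inZ z) (inX x)) 0.
Proof.
apply: (near_eq_is_derive (near_warped 0 z x 0)).
rewrite (_ : (fun u => _) = cst 0); first exact: is_derive_cst.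
by apply/funext => u'; rewrite dotg0l dotg0r mulr0 addr0.
Qed.

Lemma derive_metric_ZXX z x y : is_derive u (inZ z) (fun u' => B u' (inX x) (inX y)) 0.
Proof.
apply: (near_eq_is_derive (near_warped x 0 y 0)).
by apply: is_derive_invariant => t; rewrite lsubZ !dotg0l !mulr0.
Qed.

Lemma is_derive_warp v :
  is_derive u v (fun u' => F (x_ u')) (F (x_ u) * lam (lsubmx v)).
Proof.
have dl : differentiable (lsubmx : 'rV[R]_(a + b) -> 'rV[R]_a) u by exact: differentiable_lsubmx.
have d := is_derive_comp v dl (Fd Uu); apply: (is_derive_eq d).
have -> : 'D_v (lsubmx : 'rV[R]_(a + b) -> 'rV[R]_a) u = lsubmx v.
  rewrite (deriveE _ dl).
  by have -> := diff_lin u (@continuous_lsubmx R 1 a b :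
    continuous (lsubmx : {linear 'rV[R]_(a + b) -> 'rV[R]_a})).
by rewrite /lam mulrC divfK.
Qed.

Lemma is_derive_warpX x : is_derive u (inX x) (fun u' => F (x_ u')) (F (x_ u) * lam x).
Proof. by rewrite -[in lam _](row_mxKl x (0 : 'rV[R]_b)); exact: is_derive_warp. Qed.

Lemma derive_log_warp v : 'D_v (fun u' : 'rV[R]_(a + b) => ln (F (x_ u'))) u = lam (lsubmx v).
Proof.
have dF : differentiable (fun u' : 'rV[R]_(a + b) => F (x_ u')) u.
  apply: (@differentiable_comp _ _ _ _ (lsubmx : 'rV[R]_(a + b) -> 'rV[R]_a) F).
    exact: differentiable_lsubmx.
  exact: Fd.
have dln : differentiable (@ln R) (F (x_ u)).
  by apply/derivable1_diffP; have [] := is_derive1_ln (Fp Uu).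
have [_ ->] := is_derive_comp v dF dln.
have [_ ->] := is_derive_warp v.
rewrite -[F (x_ u) * _]mulr1 -[_ * 1]/((F (x_ u) * lam (lsubmx v)) *: (1 : R)).
rewrite deriveZl//; have [_ ->] := is_derive1_ln (Fp Uu).
by rewrite /GRing.scale/= mulrAC mulfV ?mul1r.
Qed.

Lemma derive_metric_XZZ x z w : is_derive u (inX x) (fun u' => B u' (inZ z) (inZ w))
  (2 * lam x * dotg (F (x_ u) ^+ 2 *: g2 (z_ u)) z w).
Proof.
apply: (near_eq_is_derive (near_warped 0 z 0 w)).
have d0 : is_derive u (inX x) (fun u' => dotg (g2 (z_ u')) z w) 0.
  by apply: is_derive_invariant => t; rewrite rsubX.
have d := is_deriveM (is_deriveM (is_derive_warpX x) (is_derive_warpX x)) d0.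
rewrite (_ : (fun u => _) = fun u => F (x_ u) * F (x_ u) * dotg (g2 (z_ u)) z w); last first.
  by apply/funext => u'; rewrite dotg0l add0r expr2.
by apply: (is_derive_eq d); rewrite /GRing.scale/= dotgZm; ring.
Qed.

Lemma hess_XXZ x y z : K (inX x) (inX y) (inZ z) = 0.
Proof.
have := koszul (derive_metric_XZ (inX x) y z) (derive_metric_XZ (inX y) x z)
  (derive_metric_ZXX z x y).
lra.
Qed.

Lemma hess_XZX x y z : K (inX x) (inZ z) (inX y) = 0.
Proof.
have := koszul (derive_metric_ZX (inX x) y z) (derive_metric_ZXX z x y)
  (derive_metric_XZ (inX y) x z).
lra.
Qed.

(** With [hess_XZX] this says that the tangential part of nabla_X Z is (X ln f) Z. *)
Lemma hess_XZZ x z w : K (inX x) (inZ z) (inZ w) =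
  lam x * dotg (F (x_ u) ^+ 2 *: g2 (z_ u)) z w.
Proof.
have := koszul (derive_metric_XZZ x z w) (derive_metric_XZ (inZ z) x w)
  (derive_metric_XZ (inZ w) x z).
lra.
Qed.

(** The first-factor component of nabla_Z W is -g(Z, W) grad ln f. It yields both the JX ln f term
    of the mixed part and the umbilicity of the second factor. *)
Lemma hess_ZZX x z w : K (inZ z) (inZ w) (inX x) =
  - (lam x * dotg (F (x_ u) ^+ 2 *: g2 (z_ u)) z w).
Proof.
have := koszul (derive_metric_ZX (inZ z) x w) (derive_metric_ZX (inZ w) x z)
  (derive_metric_XZZ x z w).
lra.
Qed.

Let g2F := F (x_ u) ^+ 2 *: g2 (z_ u).
Let T x z w := dotg (G (psi u)) (cov_acs G J (psi u) (inX x *m A u) (inZ z *m A u)) (inZ w *m A u).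

Let Jskew : \forall y \near psi u, J y *m G y = - (G y *m (J y)^T) :=
  near_codomain Yu acs_skew.

(* Differentiate [g (J X, W) = 0] along Z, where JX is tangent to the first
   factor at every point. *)
Lemma hess_XZ_acs (C : 'M[R]_a) x z w :
  (forall x, inX x *m A u *m J (psi u) = inX (x *m C) *m A u) ->
  dotg (G (psi u)) (H (inX x) (inZ z) *m J (psi u)) (inZ w *m A u) =
  T x z w + lam (x *m C) * dotg g2F z w.
Proof.
move=> CE.
pose V u' := coord_field psi (inX x) u' *m J (psi u').
have dx := @dcf (inZ z) (inX x).
have dw := @dcf (inZ z) (inZ w).
have dV : derivable V u (inZ z) by have [] := is_derive_acs_along psid (Jd Yu) dx.
have d := is_derive_metric_along psid (Gd Yu) nGs Gu dV dw.
have d0 : is_derive u (inZ z)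
    (fun u' => dotg (G (psi u')) (V u') (coord_field psi (inZ w) u')) 0.
  (* The matrix [C'] varies with the point and is never differentiated; only the vanishing of this
     product near [u] matters. *)
  have E : \near u, 0 = dotg (G (psi u)) (V u) (coord_field psi (inZ w) u).
    apply: near_domain => // u' Uu'; have [C' C'E] := holo Uu'.
    by rewrite /V /coord_field C'E -dotg_congr warped// dotg_block dotg0l dotg0r addr0.
  exact: (near_eq_is_derive E (is_derive_cst _ _ _)).
move: d0 d => [_ d0] [_]; rewrite d0.
rewrite nabla_along_acs//; last exact: Jd.
rewrite /V /coord_field CE dotgDl (dotgC (inX _ *m _) _ (Gs Yu)).
have := hess_ZZX (x *m C) z w; rewrite /K /H /hess /coord_field => ->.
rewrite -/(coord_field psi (inX x)) -/(hess psi G u (inZ z) (inX x)).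
rewrite (hessC Uopen psis Uu nGs).
rewrite (cov_acsC (Jd Yu) nGs (nk Yu)) dotgNl /T /g2F.
lra.
Qed.

(* The value of the derivative of [slant_form] along X is three times the
   nabla J term, by skewness of the latter and symmetry of [hess]. *)
Definition slant_form_deriv (x : 'rV[R]_a) : 'M[R]_b :=
  \matrix_(i, j) (3 * T x (delta_mx 0 i) (delta_mx 0 j)).

Let Tskew x z w : T x z w = - T x w z.
Proof.
by rewrite /T (dotg_cov_acs_skew (Gd Yu) (Jd Yu) nGs Gu Jskew).
Qed.

Lemma is_derive_slant_form x : is_derive u (inX x) slant_form (slant_form_deriv x).
Proof.
have [C CE] := holo Uu.
apply/is_derive_mxP => i j; set z := delta_mx 0 i : 'rV[R]_b; set w := delta_mx 0 j : 'rV[R]_b.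
pose V u' := coord_field psi (inZ z) u' *m J (psi u').
have dz := @dcf (inX x) (inZ z).
have dw := @dcf (inX x) (inZ w).
have dV : derivable V u (inX x) by have [] := is_derive_acs_along psid (Jd Yu) dz.
have d := is_derive_metric_along psid (Gd Yu) nGs Gu dV dw.
rewrite (_ : (fun y => _) = fun u' =>
    dotg (G (psi u')) (V u') (coord_field psi (inZ w) u')); last first.
  by apply/funext => u'; rewrite /V /coord_field slant_formE dotg_delta.
apply: (is_derive_eq d); rewrite mxE -/z -/w.
rewrite nabla_along_acs//; last exact: Jd.
(* These enter with opposite signs: the warping terms cancel by symmetry of [g2F], and T(z, w) -
   T(w, z) adds two copies of T(z, w) to the one from [nabla_along_acs]. *)
have b1 := hess_XZ_acs x z w CE; have b2 := hess_XZ_acs x w z CE.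
rewrite dotgDl {1}/coord_field -/(coord_field psi (inZ z)) -/(hess psi G u _ _) b1.
rewrite /V dotg_acsN// (dotgC (coord_field _ _ _) _ (Gs Yu)).
rewrite -/(hess psi G u (inX x) (inZ w)) b2 -/(T x z w).
have := Tskew x w z; have -> : dotg g2F w z = dotg g2F z w.
  by apply: dotgC; rewrite linearZ/= g2s.
rewrite /T /coord_field; lra.
Qed.

Lemma dotg_slant_form_deriv x z w : dotg (slant_form_deriv x) z w = 3 * T x z w.
Proof.
have bT : bilin (fun z w => 3 * T x z w : R^o).
  have TDr v v' t : T x t (v + v') = T x t v + T x t v'.
    by rewrite /T -[0 as X in row_mx X (v + v')](addr0 0) -add_row_mx mulmxDl dotgDr.
  have TZr v t k : T x t (k *: v) = k * T x t v.
    by rewrite /T -[0 as X in row_mx X (k *: v)](scaler0 _ k) -scale_row_mx -scalemxAl dotgZr.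
  apply: bilin_intro => [v v' t|k v t|v t t'|k v t].
  - by rewrite Tskew TDr opprD -!(Tskew x _ t) mulrDr.
  - by rewrite Tskew TZr -mulrN -Tskew mulrCA.
  - by rewrite TDr mulrDr.
  - by rewrite TZr mulrCA.
rewrite bT dotg_sumE; apply: eq_bigr => i _; apply: eq_bigr => j _.
by rewrite mxE mulrAC.
Qed.

Lemma slant_form_skew : (slant_form u)^T = - slant_form u.
Proof.
apply: dotg_inj => z w; rewrite dotgNm dotg_tr -!slant_formE.
by rewrite dotg_acsN// (dotgC _ _ (Gs Yu)).
Qed.

Lemma slant_form_deriv_skew x : (slant_form_deriv x)^T = - slant_form_deriv x.
Proof. by apply/matrixP => i j; rewrite !mxE Tskew mulrN. Qed.

Let g2Fs : g2F^T = g2F.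
Proof. by rewrite /g2F linearZ/= g2s. Qed.

Let g2Fp : posdef g2F.
Proof. by move=> v v0; rewrite dotgZm mulr_gt0 ?g2p// exprn_gt0// Fp. Qed.

(* The slant relation fixes the length of the fundamental form of the slant
   factor relative to the undeformed metric [g2], which does not vary in the
   direction of the first factor. *)
Lemma mxtrace_slant_form_deriv x :
  \tr (slant_form_deriv x *m invmx g2F *m (slant_form u)^T *m invmx g2F) =
  2 * lam x * (c2 * b%:R).
Proof.
set om := slant_form u; set dom := slant_form_deriv x.
pose gam := invmx (g2 (z_ u)).
have g2u u' : U u' -> g2 (z_ u') \in unitmx by move=> Uu'; exact/posdef_unit/g2p.
have dg : is_derive u (inX x) (fun u' => invmx (g2 (z_ u'))) 0.
  by apply: is_derive_invariant => t; rewrite rsubX.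
have dom' := is_derive_slant_form x.
have d := is_derive_mxtrace (is_derive_mulmx (is_derive_mulmx (is_derive_mulmx dom' dg)
  (is_derive_trmx dom')) dg).
have dF := is_derive_warpX x.
have dFF := is_deriveM dF dF.
have d4 := is_deriveM (is_deriveM dFF dFF) (is_derive_cst (c2 * b%:R) u (inX x)).
(* Trace of the slant relation with [g2] in place of the warped metric: each of the two inverse
   metrics releases a factor F^2, so the squared norm of the form relative to [g2] is F^4 c2 b. *)
have E : \near u, \tr (slant_form u *m invmx (g2 (z_ u)) *m (slant_form u)^T *m invmx (g2 (z_ u))) =
    (F (x_ u) * F (x_ u)) * (F (x_ u) * F (x_ u)) * (c2 * b%:R).
  apply: near_domain => // u' Uu'.
  have F'0 : F (x_ u') != 0 by rewrite gt_eqF// Fp.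
  have := slant Uu'; rewrite invmxZ; last first.
    by rewrite unitmxZ ?g2u// unitfE expf_neq0.
  rewrite -scalemxAr -scalemxAl => /(congr1 (fun M => F (x_ u') ^+ 2 *: M)).
  rewrite !scalerA mulfV ?expf_neq0// scale1r => ->.
  rewrite -scalemxAl mulmxV ?g2u// mxtraceZ mxtrace1; ring.
have := is_derive_near_unique E d d4.
rewrite !mulmx0 !addr0 mulmxDl mxtraceD -/gam -/om -/dom.
rewrite (mxtrace_twist_sym om dom); last by rewrite trmx_inv g2s.
rewrite /g2F invmxZ; last by rewrite unitmxZ ?g2u// unitfE expf_neq0.
rewrite -!(scalemxAr, scalemxAl) !mxtraceZ -/gam => E2.
have {}E2 : \tr (dom *m gam *m om^T *m gam) =
    F (x_ u) ^+ 4 * (2 * lam x * (c2 * b%:R)).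
  move: E2; rewrite !fctE /GRing.scale/= mulr0 add0r => E2.
  (* The product rule produced the same trace twice, so the logarithmic derivative 4 (X ln f) of F^4
     is halved. *)
  by apply: (@mulfI _ 2) => //; rewrite mulr_natl mulr2n E2; ring.
by rewrite E2; field.
Qed.

Let BG := induced_metric G psi u.
Let BGs : BG^T = BG.
Proof. by rewrite /BG /induced_metric AG tr_block_mx !trmx0 g1s// -/g2F g2Fs. Qed.
Let BGp : posdef BG.
Proof. by rewrite /BG /induced_metric AG; apply: posdef_block => //; exact: g1p. Qed.
Let AGu : A u *m G (psi u) *m (A u)^T \in unitmx := posdef_unit BGp.
Let h := sff G psi u.

Let hE v w : h v w = normal (G (psi u)) (A u) (H v w). Proof. by []. Qed.
Let hC v w : h v w = h w v.
Proof. by rewrite !hE /H (hessC Uopen psis Uu nGs). Qed.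
Let hDl v v' w : h (v + v') w = h v w + h v' w.
Proof. by rewrite !hE /H (hessDl Uopen psis Uu nGs) normalD. Qed.
Let hZl t v w : h (t *: v) w = t *: h v w.
Proof. by rewrite !hE /H (hessZl Uopen psis Uu nGs) normalZ. Qed.
Let h_normal v w z : dotg (G (psi u)) (h v w) (z *m A u) = 0.
Proof. by rewrite hE dotg_normal. Qed.

Lemma dotg_tangent_split (v : 'rV[R]_m) :
  (forall x, dotg (G (psi u)) v (inX x *m A u) = 0) ->
  (forall z, dotg (G (psi u)) v (inZ z *m A u) = 0) ->
  forall w, dotg (G (psi u)) v (w *m A u) = 0.
Proof.
move=> vX vZ w; have -> : w = inX (lsubmx w) + inZ (rsubmx w).
  by rewrite add_row_mx addr0 add0r hsubmxK.
by rewrite mulmxDl dotgDr vX vZ addr0.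
Qed.

Let AGE v w : dotg (G (psi u)) (v *m A u) (w *m A u) = dotg BG v w.
Proof. by rewrite -dotg_congr. Qed.

Let BGE v1 v2 w1 w2 : dotg BG (row_mx v1 v2) (row_mx w1 w2) =
  dotg (g1 (x_ u)) v1 w1 + dotg g2F v2 w2.
Proof. by rewrite /BG /induced_metric AG dotg_block. Qed.

(** The tangential part to be removed is known from [hess_XZX] and [hess_XZZ]. *)
Lemma sff_mixed x z : h (inX x) (inZ z) = H (inX x) (inZ z) - lam x *: (inZ z *m A u).
Proof.
rewrite hE /normal scalemxAl; congr (_ - _); apply: tangential_uniq => //.
apply: rows_orth; apply: dotg_tangent_split => w; rewrite dotgBl AGE scale_row_mx BGE.
  by rewrite -/(K _ _ _) hess_XZX !scaler0 dotg0l dotg0r addr0 subr0.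
by rewrite -/(K _ _ _) hess_XZZ scaler0 dotg0l add0r dotgZl subrr.
Qed.

(** Moving J to the other argument reduces the term with [hess] to [hess_XZ_acs] and the subtracted
    tangential part to [slant_form]; the nabla J term is then a third of [slant_form_deriv]. *)
Lemma sff_mixed_acs (C : 'M[R]_a) x z w :
  (forall x, inX x *m A u *m J (psi u) = inX (x *m C) *m A u) ->
  dotg (G (psi u)) (h (inX x) (inZ z)) (inZ w *m A u *m J (psi u)) =
  - lam (x *m C) * dotg g2F z w +
  dotg (lam x *: slant_form u - 3^-1 *: slant_form_deriv x) z w.
Proof.
move=> CE; rewrite sff_mixed dotgBl dotgZl.
have -> : dotg (G (psi u)) (H (inX x) (inZ z)) (inZ w *m A u *m J (psi u)) =
    - (T x z w + lam (x *m C) * dotg g2F z w).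
  by rewrite -(hess_XZ_acs _ _ _ CE) dotg_acsN// opprK.
have -> : dotg (G (psi u)) (inZ z *m A u) (inZ w *m A u *m J (psi u)) =
    - dotg (slant_form u) z w.
  by rewrite -slant_formE dotg_acsN// opprK.
by rewrite dotgDm dotgNm !dotgZm dotg_slant_form_deriv; field.
Qed.

Variable s2 : R.
Hypotheses (s2_gt0 : 0 < s2) (s2E : s2 = 1 - c2).

Lemma mixed_sff_estimate (E1 : 'M[R]_a) (E2 : 'M[R]_b) :
  E1 *m g1 (x_ u) *m E1^T = 1%:M -> E2 *m g2F *m E2^T = 1%:M ->
  b%:R * (s2^-1 + 9^-1 * (c2 / s2)) * \sum_i lam (row i E1) ^+ 2 <=
  \sum_i \sum_j dotg (G (psi u)) (h (inX (row i E1)) (inZ (row j E2)))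
                                 (h (inX (row i E1)) (inZ (row j E2))).
Proof.
move=> E1G E2G; have [C CE] := holo Uu.
(* J preserves the ambient metric, which restricts to [g1] on the first factor. *)
have CG : C *m g1 (x_ u) *m C^T = g1 (x_ u).
  apply: dotg_inj => x y; rewrite dotg_congr.
  have := JG Yu (inX x *m A u) (inX y *m A u).
  by rewrite !CE !AGE !BGE !dotg0l !addr0.
under eq_bigr do rewrite log_warpE.
apply: (mixed_estimate (Gs Yu) (Gp Yu) AG (posdef_unit g2Fp) g2Fs (JG Yu)
  (slant_formE u) (slant Uu) s2_gt0 s2E h_normal CG slant_form_skew slant_form_deriv_skew
  _ _ E1G E2G) => [x|x z w].
  by rewrite -log_warpE; exact: mxtrace_slant_form_deriv.
by rewrite -!log_warpE; exact: sff_mixed_acs.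
Qed.

Let onE : onframe BG *m block_mx (g1 (x_ u)) 0 0 g2F *m (onframe BG)^T = 1%:M.
Proof. by rewrite -AG; exact: onframeP. Qed.

(** Parseval in a block frame; ln f is constant along the second factor, whose half of the frame
    contributes nothing. *)
Lemma grad_sqnorm_frame (E1 : 'M[R]_a) : E1 *m g1 (x_ u) *m E1^T = 1%:M ->
  grad_sqnorm G psi (fun u' => ln (F (x_ u'))) u = \sum_i lam (row i E1) ^+ 2.
Proof.
move=> E1G; rewrite /grad_sqnorm /grad -/BG.
set S := [set v | _]; have gradP : S (xget 0 S).
  (* The gradient with respect to [g1], extended by zero, shows that the set from which [grad]
     chooses is nonempty. *)
  case: xgetP => // /(_ (row_mx (log_warp_col^T *m invmx (g1 (x_ u))) 0)); case=> w.
  rewrite -[w]hsubmxK BGE dotg0l addr0 derive_log_warp row_mxKl log_warpE.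
  rewrite /dotg mulmxKV ?posdef_unit//; last exact: g1p.
  by rewrite -trmx_mul mxE.
have [E2 E2G] := orthonormal_frame_exists g2Fs g2Fp.
have E12G : block_mx E1 0 0 E2 *m BG *m (block_mx E1 0 0 E2)^T = 1%:M.
  by rewrite /BG /induced_metric AG; exact: block_frame.
rewrite -(parseval _ E12G).
rewrite (sum_block_frame E1 E2 (fun v => dotg BG (xget 0 S) v ^+ 2)).
rewrite [X in _ + X]big1 ?addr0 => [|i _]; last first.
  by rewrite gradP derive_log_warp row_mxKl log_warpE mul0mx mxE expr0n.
by apply: eq_bigr => i _; rewrite gradP derive_log_warp row_mxKl.
Qed.

Lemma sff_sqnorm_ge : 2 * (b%:R * (s2^-1 + 9^-1 * (c2 / s2))) *
    grad_sqnorm G psi (fun u' => ln (F (x_ u'))) u <= sff_sqnorm G psi u.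
Proof.
have [E1 E1G] := orthonormal_frame_exists (g1s Uu) (g1p Uu).
have [E2 E2G] := orthonormal_frame_exists g2Fs g2Fp.
apply: le_trans (frame_sqnorm_split_ge (Gp Yu) hDl hZl hC E1G E2G onE).
by rewrite (grad_sqnorm_frame E1G) -mulrA ler_pM2l// mixed_sff_estimate.
Qed.

Lemma sff_sqnorm_eq : sff_sqnorm G psi u = 2 * (b%:R * (s2^-1 + 9^-1 * (c2 / s2))) *
    grad_sqnorm G psi (fun u' => ln (F (x_ u'))) u ->
  (forall x y, h (inX x) (inX y) = 0) /\ (forall z w, h (inZ z) (inZ w) = 0).
Proof.
have [E1 E1G] := orthonormal_frame_exists (g1s Uu) (g1p Uu).
have [E2 E2G] := orthonormal_frame_exists g2Fs g2Fp.
move=> eq_h; apply: (frame_sqnorm_split_eq (Gp Yu) hDl hZl hC E1G E2G onE).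
rewrite -[leLHS]/(sff_sqnorm G psi u) eq_h.
by rewrite (grad_sqnorm_frame E1G) -mulrA ler_pM2l// mixed_sff_estimate.
Qed.

Hypothesis hXX : forall x y, h (inX x) (inX y) = 0.
Hypothesis hZZ : forall z w, h (inZ z) (inZ w) = 0.

(** The trace may be taken in a block frame, where only unmixed pairs occur. *)
Lemma mean_curvature_eq0 : mean_curvature G psi u = 0.
Proof.
have [E1 E1G] := orthonormal_frame_exists (g1s Uu) (g1p Uu).
have [E2 E2G] := orthonormal_frame_exists g2Fs g2Fp.
have hb : bilin h.
  apply: bilin_intro => [v v' w|t v w|v w w'|t v w]; rewrite ?hDl ?hZl//.
    by rewrite !(hC v) hDl.
  by rewrite !(hC v) hZl.
rewrite /mean_curvature (bilin_frame_sum_eq hb onE (block_frame E1G E2G)).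
rewrite (sum_block_frame E1 E2 (fun v => h v v)) !big1 ?addr0 ?scaler0//.
Qed.

Let A1 := usubmx (A u).
Let A2 := dsubmx (A u).

Lemma inX_mul x : inX x *m A u = x *m A1.
Proof. by rewrite -[in LHS](vsubmxK (A u)) mul_row_col mul0mx addr0. Qed.

(** Where [h] vanishes, the ambient covariant derivative is tangent, so the components computed by
    [koszul] determine it completely. *)
Lemma hess_tangent v w : h v w = 0 -> exists t1 t2,
  [/\ H v w = t1 *m A1 + t2 *m A2,
      forall x, dotg (g1 (x_ u)) t1 x = K v w (inX x) &
      forall z, dotg g2F t2 z = K v w (inZ z)].
Proof.
move=> /eqP; rewrite hE /normal subr_eq0 /tangential; set t := _ *m invmx _ => /eqP HE.
exists (lsubmx t), (rsubmx t); rewrite -/(A u) in HE.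
have E : H v w = t *m A u by [].
split=> [|x|z].
- by rewrite E -{1}(hsubmxK t) -{1}(vsubmxK (A u)) mul_row_col.
- by rewrite /K E AGE -{2}(hsubmxK t) BGE dotg0r addr0.
- by rewrite /K E AGE -{2}(hsubmxK t) BGE dotg0r add0r.
Qed.

Let A1G : A1 *m G (psi u) *m A1^T = g1 (x_ u).
Proof.
by apply: dotg_inj => v w; rewrite dotg_congr -!inX_mul AGE BGE dotg0l addr0.
Qed.

Let A2G : A2 *m G (psi u) *m A2^T = g2F.
Proof.
by apply: dotg_inj => v w; rewrite dotg_congr -!inZ_mul AGE BGE dotg0l add0r.
Qed.

(** By [hess_XXZ] the tangent vector nabla_X Y has no second-factor component, hence it is tangent
    to the leaf. *)
Lemma leaf1_sff_eq0 x y : normal (G (psi u)) A1 (H (inX x) (inX y)) = 0.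
Proof.
have [t1 [t2 [-> _ t2E]]] := hess_tangent (hXX x y).
have -> : t2 = 0.
  apply: (dotg_eq0 (posdef_unit g2Fp)) => z; rewrite t2E; exact: hess_XXZ.
rewrite mul0mx addr0 /normal (@tangential_uniq _ _ _ _ _ _ _ t1) ?subrr//.
  by rewrite A1G; exact/posdef_unit/g1p.
by rewrite !mul0mx.
Qed.

(** The vector on the right is minus the push-forward of grad ln f. It is the same for all [z] and
    [w], which is umbilicity. *)
Lemma leaf2_sff z w : normal (G (psi u)) A2 (H (inZ z) (inZ w)) =
  dotg g2F z w *: - (log_warp_col^T *m invmx (g1 (x_ u)) *m A1).
Proof.
have [t1 [t2 [-> t1E _]]] := hess_tangent (hZZ z w).
have -> : t1 = - (dotg g2F z w *: (log_warp_col^T *m invmx (g1 (x_ u)))).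
  apply/eqP; rewrite -addr_eq0; apply/eqP.
  apply: (dotg_eq0 (posdef_unit (g1p Uu))) => x.
  rewrite dotgDl t1E hess_ZZX dotgZl /dotg mulmxKV ?posdef_unit//; last exact: g1p.
  rewrite -trmx_mul [_^T 0 0]mxE -log_warpE; ring.
rewrite /normal (@tangential_uniq _ _ _ _ _ _ _ t2).
- by rewrite addrK mulNmx scalerN -scalemxAl.
- by rewrite A2G; exact/posdef_unit/g2Fp.
rewrite addrK; apply: rows_orth => v.
by rewrite -inX_mul -inZ_mul AGE BGE dotg0l dotg0r addr0.
Qed.

End AtPoint.
End WarpedImmersion.

(** * Leaves and charts *)

Section AffineRestriction.
Variables (R : realType) (k n m : nat) (U : set 'rV[R]_n).
Variables (psi : 'rV[R]_n -> 'rV[R]_m) (G : 'rV[R]_m -> 'M[R]_m).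
Variables (L : 'M[R]_(k, n)) (c : 'rV[R]_n).
Hypotheses (Uopen : open U) (psis : smooth_on U psi).
Let iota (x : 'rV[R]_k) := x *m L + c.

Lemma differentiable_affine x : differentiable iota x.
Proof.
rewrite (_ : iota = (\sum_i (fun x : 'rV[R]_k => x 0 i *: row i L)) + cst c); last first.
  by apply/funext => y; rewrite /iota fctE fct_sumE mulmx_sum_row.
apply: differentiableD; last exact: differentiable_cst.
apply: differentiable_sum => i; apply: differentiableZl.
exact: differentiable_coord.
Qed.

Lemma derive_affine (W : normedModType R) (f : 'rV[R]_n -> W) v x :
  'D_v (f \o iota) x = 'D_(v *m L) f (iota x).
Proof.
have E : (fun h : R => h^-1 *: (((f \o iota) \o shift x) (h *: v) - (f \o iota) x)) =
    (fun h : R => h^-1 *: ((f \o shift (iota x)) (h *: (v *m L)) - f (iota x))).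
  by apply/funext => h /=; rewrite /iota mulmxDl -scalemxAl addrA.
by rewrite /derive E.
Qed.

Lemma jacobian_affine x : U (iota x) ->
  jacobian (psi \o iota) x = L *m jacobian psi (iota x).
Proof.
move=> Ux; have d := smooth_differentiable psis Ux.
have dx := differentiable_affine x.
apply/row_matrixP => i; rewrite !rowE mulmxA.
have dc : differentiable (psi \o iota) x by apply: differentiable_comp.
by rewrite -(deriveEjacobian _ dc) derive_affine (deriveEjacobian _ d).
Qed.

(** A leaf is an affine slice of a product chart: the covariant derivative is that of the whole
    immersion, and only the space projected away changes. *)
Lemma sff_affine x v w : U (iota x) -> sff G (psi \o iota) x v w =
  normal (G (psi (iota x))) (L *m jacobian psi (iota x))
    (hess psi G (iota x) (v *m L) (w *m L)).
Proof.
move=> Ux; rewrite /sff jacobian_affine//; congr normal.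
rewrite /nabla_along /hess /nabla_along jacobian_affine// !mulmxA; congr (_ + _).
(* The formula for the Jacobian is needed in a neighbourhood, as the field is differentiated once
   more. *)
rewrite -derive_affine; apply: near_eq_derive.
have near_x : \forall y \near x, U (iota y).
  apply: (differentiable_continuous (differentiable_affine x)).
  exact: (open_nbhs_nbhs (conj Uopen Ux)).
by apply: filterS near_x => y Uy; rewrite jacobian_affine// mulmxA.
Qed.

End AffineRestriction.

(** * The slant condition as a matrix identity *)

Section SlantAngle.
Variables (R : realType) (m n : nat) (G J : 'M[R]_m) (A : 'M[R]_(n, m)) (theta : R).
Hypotheses (Gs : G^T = G) (Gp : posdef G) (gp : posdef (A *m G *m A^T)).
Hypothesis JG : forall v w, dotg G (v *m J) (w *m J) = dotg G v w.
Hypothesis slantA : forall v : 'rV[R]_n, v != 0 -> angle_with G A (v *m A *m J) = theta.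

Let g := A *m G *m A^T.
Let gs : g^T = g. Proof. by rewrite /g !trmx_mul trmxK Gs mulmxA. Qed.
Let gu : g \in unitmx. Proof. exact: posdef_unit. Qed.

Lemma dotg_tangential_normal v :
  dotg G v v = dotg G (tangential G A v) (tangential G A v) + dotg G (normal G A v) (normal G A v).
Proof.
have vE : v = tangential G A v + normal G A v by rewrite addrC subrK.
have : dotg G (normal G A v) (tangential G A v) = 0 by rewrite /tangential dotg_normal.
rewrite {3 4}vE; move: (tangential G A v) (normal G A v) => t w wt.
by rewrite !dotgDl !dotgDr (dotgC t w Gs) wt; ring.
Qed.

Lemma tangential_slant v :
  dotg G (tangential G A (v *m A *m J)) (tangential G A (v *m A *m J)) =
  cos theta ^+ 2 * dotg g v v.
Proof.
have [->|v0] := eqVneq v 0.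
  by rewrite /tangential !mul0mx !dotg0l mulr0.
have vA0 : 0 < dotg g v v by exact: gp.
set w := v *m A *m J; have wE : dotg G w w = dotg g v v by rewrite JG -dotg_congr.
have TE := dotg_tangential_normal w.
have T0 := posdef_ge0 (tangential G A w) Gp; have N0 := posdef_ge0 (normal G A w) Gp.
(* Pythagoras puts the quotient of lengths in [0, 1], where [cos] inverts [acos]. *)
rewrite -(slantA v0) /angle_with -/w acosK; last first.
  rewrite in_itv/= (le_trans _ (divr_ge0 (sqrtr_ge0 _) (sqrtr_ge0 _))) ?lerN10//=.
  rewrite ler_pdivrMr ?sqrtr_gt0 ?wE// mul1r ler_sqrt ?wE//; last exact: ltW.
  by rewrite -wE TE lerDl.
rewrite expr_div_n !sqr_sqrtr// wE ?mulfVK// ?gt_eqF// ltW//.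
Qed.

(** The left side is the Gram matrix of the tangential parts of JV, so [tangential_slant] gives the
    identity on the diagonal and polarization elsewhere. *)
Lemma slant_relation :
  (A *m J *m G *m A^T) *m invmx g *m (A *m J *m G *m A^T)^T = cos theta ^+ 2 *: g.
Proof.
set om := A *m J *m G *m A^T.
apply: dotg_sym_inj => [||v].
- by rewrite !trmx_mul !trmxK trmx_inv gs !mulmxA.
- by rewrite linearZ/= gs.
rewrite dotgZm -tangential_slant /tangential -dotg_congr -/g.
have -> : v *m A *m J *m G *m A^T = v *m om by rewrite /om !mulmxA.
rewrite /dotg mulmxKV//; congr (fun_of_matrix _ 0 0).
rewrite [in RHS]trmx_mul [in RHS](trmx_mul v) trmx_inv gs.
by move: om => M; rewrite !mulmxA.
Qed.

(** The normal part of JV has squared length sin^2 theta times that of V. The lemma serves to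
    exclude a vanishing sine for proper slant leaves. *)
Lemma slant_angle0_holomorphic : sin theta = 0 -> (A *m J <= A)%MS.
Proof.
move=> s0; have c1 : cos theta ^+ 2 = 1 by rewrite cos2sin2 s0 expr0n subr0.
apply/row_subP => i; rewrite row_mul rowE.
set v := delta_mx 0 i; set w := v *m A *m J.
have wE : dotg G w w = dotg g v v by rewrite JG -dotg_congr.
have := dotg_tangential_normal w; rewrite tangential_slant c1 mul1r wE => E.
have /(posdef_eq0 Gp)/eqP : dotg G (normal G A w) (normal G A w) = 0 by lra.
by rewrite subr_eq0 => /eqP ->; rewrite /tangential submxMl.
Qed.

End SlantAngle.

(** * Charts of the product adapted to the immersion *)

Section ProductCharts.
Variables (R : realType) (a b m : nat).
Variables (N1 : manifold R a) (N2 : manifold R b) (M : manifold R m).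
Variable phi : prod_charted N1 N2 -> M.
Hypothesis phic : continuous phi.

Lemma prod_crdK (p : prod_charted N1 N2) (i : idx (prod_charted N1 N2)) :
  dom (prod_charted N1 N2) i p ->
  par (prod_charted N1 N2) i (crd (prod_charted N1 N2) i p) = p.
Proof.
case: p => x y [/= dx dy]; rewrite row_mxKl row_mxKr.
by rewrite (crdK (manifoldP N1) dx) (crdK (manifoldP N2) dy).
Qed.

Definition chart_domain (i : idx (prod_charted N1 N2)) (j : idx M) : set 'rV[R]_(a + b) :=
  crd (prod_charted N1 N2) i @` [set p | charts_at phi p i j].

Lemma chart_domain_open i j : open (chart_domain i j).
Proof.
rewrite openE => _ [[x y] [[/= dx dy] dxy] <-] /=.
have cl := @continuous_lsubmx R 1 a b (row_mx (crd N1 i.1 x) (crd N2 i.2 y)).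
have cr := @continuous_rsubmx R 1 a b (row_mx (crd N1 i.1 x) (crd N2 i.2 y)).
rewrite /continuous_at row_mxKl in cl; rewrite /continuous_at row_mxKr in cr.
have ix : chart_image i.1 (crd N1 i.1 x) by exists x.
have iy : chart_image i.2 (crd N2 i.2 y) by exists y.
have o1 : open (chart_image (M := N1) i.1) by exact: (chart_image_open (manifoldP N1)).
have o2 : open (chart_image (M := N2) i.2) by exact: (chart_image_open (manifoldP N2)).
have nx := open_nbhs_nbhs (conj o1 ix); have ny := open_nbhs_nbhs (conj o2 iy).
have px : par N1 i.1 @ crd N1 i.1 x --> par N1 i.1 (crd N1 i.1 x).
  exact: (par_continuous (manifoldP N1) ix).
have py : par N2 i.2 @ crd N2 i.2 y --> par N2 i.2 (crd N2 i.2 y).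
  exact: (par_continuous (manifoldP N2) iy).
rewrite (crdK (manifoldP N1) dx) in px; rewrite (crdK (manifoldP N2) dy) in py.
have nphi : nbhs (x, y) (phi @^-1` dom M j).
  by apply: phic; apply: open_nbhs_nbhs; split => //; exact: (dom_open (manifoldP M)).
have cpair : (fun u : 'rV[R]_(a + b) => (par N1 i.1 (lsubmx u), par N2 i.2 (rsubmx u)))
    @ row_mx (crd N1 i.1 x) (crd N2 i.2 y) --> (x, y).
  have c1 := cvg_comp _ _ cl px; have c2 := cvg_comp _ _ cr py.
  by apply: (cvg_pair c1 c2).
set u0 := row_mx (crd N1 i.1 x) (crd N2 i.2 y).
have n1 : \forall u \near u0, chart_image i.1 (lsubmx u) := cl _ nx.
have n2 : \forall u \near u0, chart_image i.2 (rsubmx u) := cr _ ny.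
have n3 : \forall u \near u0, dom M j (phi (par N1 i.1 (lsubmx u), par N2 i.2 (rsubmx u))).
  exact: (cpair _ nphi).
change (\forall u \near u0, chart_domain i j u).
move: n1 n2 n3; apply: filterS3 => u [x' dx' x'E] [y' dy' y'E] /= dphi.
rewrite -x'E -y'E (crdK (manifoldP N1) dx') (crdK (manifoldP N2) dy') in dphi.
exists (x', y'); first by split.
by rewrite /= x'E y'E hsubmxK.
Qed.

Lemma local_expr_chart (i : idx (prod_charted N1 N2)) (j : idx M) u :
  chart_domain i j u -> chart_image j (local_expr phi i j u).
Proof.
move=> [p [dp dphi] <-]; rewrite /local_expr /comp prod_crdK//.
by exists (phi p).
Qed.

End ProductCharts.

(** The condition is tested on the constant field [v], all of whose derivatives vanish. *)
Lemma nearly_kaehler_cov_acs (R : realType) (n : nat) (M : charted R n) (J g : tensor2 M)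
    (j : idx M) y : is_nearly_kaehler J g -> chart_image j y ->
  forall v, cov_acs (g j) (J j) y v v = 0.
Proof.
move=> [[[Js _ _] _ _] nk] Yy v.
have := nk j (fun=> v) (smooth_cst _ v) y Yy.
have Jd : is_derive y v (fun u => v *m J j u) (v *m 'D_v (J j) y).
  by apply/is_derive_mulmxl/differentiable_is_derive; exact: smooth_differentiable (Js j) Yy.
rewrite /nabla derive_cst add0r; have [_ ->] := Jd.
exact.
Qed.

(** * From local coordinates to the manifold *)

Section WarpedSemiSlant.
Variables (R : realType) (m a b : nat) (Mbar : manifold R m) (J g : tensor2 Mbar).
Variables (NT : manifold R a) (Nth : manifold R b).
Variables (gT : tensor2 NT) (gth : tensor2 Nth) (f : NT -> R).
Variables (phi : prod_charted NT Nth -> Mbar) (theta : R).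
Hypothesis nearly_kaehler : is_nearly_kaehler J g.
Hypothesis semi_slant : is_warped_semi_slant J g gT gth f phi theta.

Let wp := wss_warped semi_slant.
Let ah := nearly_kaehler.1.
Let riem := ah_riemannian ah.

Section Chart.
Variables (i : idx (prod_charted NT Nth)) (j : idx Mbar).
Let psi := local_expr phi i j.
Let U := chart_domain phi i j.
Let Y := chart_image (M := Mbar) j.
Let F := f \o par NT i.1.

Let phic : continuous phi.
Proof. by have [] := wp_immersion wp. Qed.

Let Uopen : open U.
Proof. exact: (chart_domain_open phic). Qed.

Let Yopen : open Y.
Proof. exact: (chart_image_open (manifoldP Mbar)). Qed.

Let psis : smooth_on U psi.
Proof. by have [_ s _] := wp_immersion wp; exact: s. Qed.

Let psiY u : U u -> Y (psi u).
Proof. exact: local_expr_chart. Qed.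

Let Gd y : Y y -> differentiable (g j) y.
Proof. exact: (smooth_differentiable (metric_smooth riem j)). Qed.

Let Jd y : Y y -> differentiable (J j) y.
Proof. exact: (smooth_differentiable (acs_smooth (ah_complex ah) j)). Qed.

Let Gs y : Y y -> (g j y)^T = g j y.
Proof. by move=> Yy; exact: (Defs.metric_sym riem). Qed.

Let Gp y : Y y -> posdef (g j y).
Proof. by move=> Yy; exact: (metric_pos riem Yy). Qed.

Let JJ y : Y y -> J j y *m J j y = - 1%:M.
Proof. by move=> Yy; apply: (acs_square (ah_complex ah)). Qed.

Let JG y : Y y -> forall v w, dotg (g j y) (v *m J j y) (w *m J j y) = dotg (g j y) v w.
Proof. by move=> Yy; apply: (ah_compatible ah). Qed.

Let nk y : Y y -> forall v, cov_acs (g j) (J j) y v v = 0.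
Proof. by move=> Yy; apply: (nearly_kaehler_cov_acs nearly_kaehler). Qed.

Let warped u : U u -> jacobian psi u *m g j (psi u) *m (jacobian psi u)^T =
  block_mx (gT i.1 (lsubmx u)) 0 0 (F (lsubmx u) ^+ 2 *: gth i.2 (rsubmx u)).
Proof. by move=> [p pij <-]; exact: (wp_induced wp pij). Qed.

Let Ul u : U u -> chart_image i.1 (lsubmx u).
Proof. by move=> [[x y] [[/= dx dy] _] <-]; rewrite row_mxKl; exists x. Qed.

Let Ur u : U u -> chart_image i.2 (rsubmx u).
Proof. by move=> [[x y] [[/= dx dy] _] <-]; rewrite row_mxKr; exists y. Qed.

Let Fd u : U u -> differentiable F (lsubmx u).
Proof. by move=> Uu; apply: (wp_warping_diff wp); exact: Ul. Qed.

Let Fp u : U u -> 0 < F (lsubmx u).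
Proof. by move=> _; exact: (wp_warping_pos wp). Qed.

Let g1s u : U u -> (gT i.1 (lsubmx u))^T = gT i.1 (lsubmx u).
Proof. by move=> Uu; exact: (Defs.metric_sym (wp_riemannian1 wp) (Ul Uu)). Qed.

Let g1p u : U u -> posdef (gT i.1 (lsubmx u)).
Proof. by move=> Uu; exact: (metric_pos (wp_riemannian1 wp) (Ul Uu)). Qed.

Let g2s u : U u -> (gth i.2 (rsubmx u))^T = gth i.2 (rsubmx u).
Proof. by move=> Uu; exact: (Defs.metric_sym (wp_riemannian2 wp) (Ur Uu)). Qed.

Let g2p u : U u -> posdef (gth i.2 (rsubmx u)).
Proof. by move=> Uu; exact: (metric_pos (wp_riemannian2 wp) (Ur Uu)). Qed.

Let L1 : 'M[R]_(a, a + b) := row_mx 1%:M 0.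
Let L2 : 'M[R]_(b, a + b) := row_mx 0 1%:M.

(** An equality of functions on the whole space: only the fixed point [y] passes through a chart and
    back. *)
Lemma local_expr_leaf1 (y : Nth) : dom Nth i.2 y ->
  local_expr (leaf1 phi y) i.1 j = psi \o (fun x => x *m L1 + row_mx 0 (crd Nth i.2 y)).
Proof.
move=> dy; apply/funext => x; rewrite /psi /local_expr /leaf1 /comp /=.
rewrite mul_mx_row mulmx1 mulmx0 add_row_mx addr0 add0r row_mxKl row_mxKr.
by rewrite (crdK (manifoldP Nth) dy).
Qed.

Lemma local_expr_leaf2 (x : NT) : dom NT i.1 x ->
  local_expr (leaf2 phi x) i.2 j = psi \o (fun y => y *m L2 + row_mx (crd NT i.1 x) 0).
Proof.
move=> dx; apply/funext => y; rewrite /psi /local_expr /leaf2 /comp /=.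
rewrite mul_mx_row mulmx1 mulmx0 add_row_mx addr0 add0r row_mxKl row_mxKr.
by rewrite (crdK (manifoldP NT) dx).
Qed.

Section Point.
Variables (x : NT) (y : Nth).
Hypothesis xy : charts_at phi (x, y) i j.
Let u : 'rV[R]_(a + b) := row_mx (crd NT i.1 x) (crd Nth i.2 y).
Let Uu : U u. Proof. by exists (x, y). Qed.
Let dx : dom NT i.1 x. Proof. by have [[]] := xy. Qed.
Let dy : dom Nth i.2 y. Proof. by have [[]] := xy. Qed.
Let A := jacobian psi u.

Let psiu : psi u = crd Mbar j (phi (x, y)).
Proof.
rewrite /psi /local_expr /comp /u /= row_mxKl row_mxKr.
by rewrite (crdK (manifoldP NT) dx) (crdK (manifoldP Nth) dy).
Qed.

Let iota1 : crd NT i.1 x *m L1 + row_mx 0 (crd Nth i.2 y) = u.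
Proof. by rewrite mul_mx_row mulmx1 mulmx0 add_row_mx addr0 add0r. Qed.

Let iota2 : crd Nth i.2 y *m L2 + row_mx (crd NT i.1 x) 0 = u.
Proof. by rewrite mul_mx_row mulmx1 mulmx0 add_row_mx addr0 add0r. Qed.

Let L1A : L1 *m A = usubmx A.
Proof. by rewrite -[in LHS](vsubmxK A) mul_row_col mul0mx mul1mx addr0. Qed.

Let L2A : L2 *m A = dsubmx A.
Proof. by rewrite -[in LHS](vsubmxK A) mul_row_col mul0mx mul1mx add0r. Qed.

Lemma tangent_map_leaf1 : tangent_map (leaf1 phi y) i.1 j x = usubmx A.
Proof.
rewrite /tangent_map local_expr_leaf1// (jacobian_affine psis) ?iota1//.
Qed.

Lemma tangent_map_leaf2 : tangent_map (leaf2 phi x) i.2 j y = dsubmx A.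
Proof.
rewrite /tangent_map local_expr_leaf2// (jacobian_affine psis) ?iota2//.
Qed.

Lemma sff_leaf1 v w : sff (g j) (local_expr (leaf1 phi y) i.1 j) (crd NT i.1 x) v w =
  normal (g j (psi u)) (usubmx A) (hess psi (g j) u (row_mx v 0) (row_mx w 0)).
Proof.
rewrite local_expr_leaf1// (sff_affine _ Uopen psis) ?iota1// L1A.
by rewrite !mul_mx_row !mulmx1 !mulmx0.
Qed.

Lemma sff_leaf2 v w : sff (g j) (local_expr (leaf2 phi x) i.2 j) (crd Nth i.2 y) v w =
  normal (g j (psi u)) (dsubmx A) (hess psi (g j) u (row_mx 0 v) (row_mx 0 w)).
Proof.
rewrite local_expr_leaf2// (sff_affine _ Uopen psis) ?iota2// L2A.
by rewrite !mul_mx_row !mulmx1 !mulmx0.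
Qed.

Let leaf2_metric : dsubmx A *m g j (psi u) *m (dsubmx A)^T =
  F (lsubmx u) ^+ 2 *: gth i.2 (rsubmx u).
Proof.
have := warped Uu; rewrite -/A -{1 2}(vsubmxK A) mul_col_mx tr_col_mx mul_col_row.
by move=> /eq_block_mx[].
Qed.

Lemma induced_metric_leaf2 :
  induced_metric (g j) (local_expr (leaf2 phi x) i.2 j) (crd Nth i.2 y) =
  F (lsubmx u) ^+ 2 *: gth i.2 (rsubmx u).
Proof.
rewrite -leaf2_metric /induced_metric local_expr_leaf2// (jacobian_affine psis) ?iota2//.
by rewrite L2A /= iota2.
Qed.

Lemma leaf1_acs : exists C : 'M[R]_a, forall z : 'rV[R]_a,
  (row_mx z 0 : 'rV[R]_(a + b)) *m A *m J j (psi u) = (row_mx (z *m C) 0 : 'rV[R]_(a + b)) *m A.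
Proof.
have ch : charts_at (leaf1 phi y) x i.1 j by have [[? ?] ?] := xy; split.
have := wss_holomorphic semi_slant ch.
rewrite tangent_map_leaf1 /acs_at /leaf1 -psiu => /andP[/submxP[C CE] _].
exists C => z.
rewrite -[in LHS](vsubmxK A) -[in RHS](vsubmxK A) !mul_row_col !mul0mx !addr0.
by rewrite -mulmxA CE mulmxA.
Qed.

Lemma leaf2_posdef : posdef (dsubmx A *m g j (psi u) *m (dsubmx A)^T).
Proof.
rewrite leaf2_metric => v v0; rewrite dotgZm mulr_gt0 ?exprn_gt0 ?Fp//.
exact: g2p.
Qed.

Lemma leaf2_angle (v : 'rV[R]_b) : v != 0 ->
  angle_with (g j (psi u)) (dsubmx A) (v *m dsubmx A *m J j (psi u)) = theta.
Proof.
move=> v0; have [sl _ _] := wss_slant semi_slant x.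
have ch : charts_at (leaf2 phi x) y i.2 j by have [[? ?] ?] := xy; split.
by have := sl y i.2 j ch v v0; rewrite tangent_map_leaf2 /metric_at /acs_at /leaf2 -psiu.
Qed.

Lemma leaf2_slant_relation : slant_form psi (g j) (J j) u *m
    invmx (F (lsubmx u) ^+ 2 *: gth i.2 (rsubmx u)) *m (slant_form psi (g j) (J j) u)^T =
  cos theta ^+ 2 *: (F (lsubmx u) ^+ 2 *: gth i.2 (rsubmx u)).
Proof.
rewrite -leaf2_metric.
exact: slant_relation (Gs (psiY Uu)) (Gp (psiY Uu)) leaf2_posdef (JG (psiY Uu)) leaf2_angle.
Qed.

Lemma leaf2_holomorphic_of_sin0 : sin theta = 0 ->
  (tangent_map (leaf2 phi x) i.2 j y *m acs_at (leaf2 phi x) J j y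
    == tangent_map (leaf2 phi x) i.2 j y)%MS.
Proof.
move=> s0; rewrite tangent_map_leaf2 /acs_at /leaf2 -psiu.
have AJ : (dsubmx A *m J j (psi u) <= dsubmx A)%MS := slant_angle0_holomorphic
  (Gs (psiY Uu)) (Gp (psiY Uu)) leaf2_posdef (JG (psiY Uu)) leaf2_angle s0.
(* The reverse inclusion follows by applying J once more, its square being minus the identity. *)
apply/andP; split => //; have := submxMr (J j (psi u)) AJ.
by rewrite -mulmxA (JJ (psiY Uu)) mulmxN mulmx1 eqmx_opp.
Qed.

End Point.

Let holoU u : U u -> exists C : 'M[R]_a, forall z : 'rV[R]_a,
  (row_mx z 0 : 'rV[R]_(a + b)) *m jacobian psi u *m J j (psi u) =
  (row_mx (z *m C) 0 : 'rV[R]_(a + b)) *m jacobian psi u.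
Proof. by move=> [[x y] xy <-]; exact: leaf1_acs. Qed.

Let slantU u : U u -> slant_form psi (g j) (J j) u *m
    invmx (F (lsubmx u) ^+ 2 *: gth i.2 (rsubmx u)) *m (slant_form psi (g j) (J j) u)^T =
  cos theta ^+ 2 *: (F (lsubmx u) ^+ 2 *: gth i.2 (rsubmx u)).
Proof. by move=> [[x y] xy <-]; exact: leaf2_slant_relation. Qed.

Hypothesis sin0 : sin theta != 0.

Let s2_gt0 : 0 < sin theta ^+ 2.
Proof. by rewrite exprn_even_gt0. Qed.

Let s2E : sin theta ^+ 2 = 1 - cos theta ^+ 2 := sin2cos2 theta.

Let lnf (p : prod_charted NT Nth) := ln (f p.1).
Let bound := 2 * (b%:R * ((sin theta ^+ 2)^-1 + 9^-1 * (cos theta ^+ 2 / sin theta ^+ 2))).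

Section Bound.
Variable p : prod_charted NT Nth.
Hypothesis pij : charts_at phi p i j.
Let u := crd (prod_charted NT Nth) i p.
Let Uu : U u. Proof. by exists p. Qed.

Lemma sff_sqnorm_at_ge : bound * grad_sqnorm_at g phi lnf p i j <= sff_sqnorm_at g phi p i j.
Proof.
exact: (sff_sqnorm_ge Uopen Yopen psis psiY Gd Jd Gs Gp JJ JG nk warped Fd Fp
  g1s g1p g2s g2p holoU slantU Uu s2_gt0 s2E).
Qed.

Hypothesis sff_eq : sff_sqnorm_at g phi p i j = bound * grad_sqnorm_at g phi lnf p i j.

Let hXX : forall x y, sff (g j) psi u (row_mx x 0) (row_mx y 0) = 0.
Proof.
by have [] := sff_sqnorm_eq Uopen Yopen psis psiY Gd Jd Gs Gp JJ JG nk warped Fd Fp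
  g1s g1p g2s g2p holoU slantU Uu s2_gt0 s2E sff_eq.
Qed.

Let hZZ : forall z w, sff (g j) psi u (row_mx 0 z) (row_mx 0 w) = 0.
Proof.
by have [] := sff_sqnorm_eq Uopen Yopen psis psiY Gd Jd Gs Gp JJ JG nk warped Fd Fp
  g1s g1p g2s g2p holoU slantU Uu s2_gt0 s2E sff_eq.
Qed.

Lemma mean_curvature_at_eq0 : mean_curvature (g j) psi u = 0.
Proof.
exact: (mean_curvature_eq0 Uopen Yopen psis psiY Gs warped Fp g1s g1p g2s g2p Uu hXX hZZ).
Qed.

Lemma sff_leaf1_eq0 v w :
  sff (g j) (local_expr (leaf1 phi p.2) i.1 j) (crd NT i.1 p.1) v w = 0.
Proof.
have xy : charts_at phi (p.1, p.2) i j by rewrite -surjective_pairing.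
rewrite (sff_leaf1 xy).
exact: (leaf1_sff_eq0 Uopen Yopen psis psiY Gd Gs Gp warped Fp g1p g2p Uu hXX).
Qed.

(** Once the second fundamental form is the metric times a fixed vector, its trace identifies that
    vector as the mean curvature. *)
Lemma sff_leaf2_umbilical : b != 0%N -> forall v w,
  sff (g j) (local_expr (leaf2 phi p.1) i.2 j) (crd Nth i.2 p.2) v w =
  dotg (induced_metric (g j) (local_expr (leaf2 phi p.1) i.2 j) (crd Nth i.2 p.2)) v w *:
    mean_curvature (g j) (local_expr (leaf2 phi p.1) i.2 j) (crd Nth i.2 p.2).
Proof.
move=> b0; have xy : charts_at phi (p.1, p.2) i j by rewrite -surjective_pairing.
pose g2F := F (lsubmx u) ^+ 2 *: gth i.2 (rsubmx u).
have g2Fs : g2F^T = g2F by rewrite /g2F linearZ/= g2s.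
have g2Fp : posdef g2F.
  by move=> v v0; rewrite dotgZm mulr_gt0 ?exprn_gt0 ?Fp//; exact: g2p.
have [H hE] : exists H, forall v w,
    sff (g j) (local_expr (leaf2 phi p.1) i.2 j) (crd Nth i.2 p.2) v w = dotg g2F v w *: H.
  (* The witness, fixed before [v] and [w], is the vector provided by [leaf2_sff]. *)
  eexists => v w; rewrite (sff_leaf2 xy).
  exact: (leaf2_sff Uopen Yopen psis psiY Gd Gs Gp warped Fd Fp g1p g2p Uu hZZ).
have gE : induced_metric (g j) (local_expr (leaf2 phi p.1) i.2 j) (crd Nth i.2 p.2) = g2F.
  exact: (induced_metric_leaf2 xy).
move=> v w; rewrite hE gE /mean_curvature gE; congr (_ *: _).
under eq_bigr do rewrite hE (frame_row _ _ (onframeP g2Fs g2Fp)) eqxx scale1r.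
by rewrite sumr_const card_ord -[H *+ b]scaler_nat scalerA mulVf ?scale1r// pnatr_eq0.
Qed.

End Bound.
End Chart.

(** Otherwise the leaf through [x] would be holomorphic. The point is an argument because proper
    slantness is asserted leaf by leaf. *)
Lemma sin_slant_neq0 (x : NT) : sin theta != 0.
Proof.
apply/eqP => s0; have [_ nholo _] := wss_slant semi_slant x.
apply: nholo => y i2 j [dy dj]; have [i1 dx] := dom_cover (manifoldP NT) x.
by apply: (@leaf2_holomorphic_of_sin0 (i1, i2) j x y) => //; split.
Qed.

(** A leaf of dimension 0 would be vacuously holomorphic. The averaging in the mean curvature needs
    this dimension to be nonzero. *)
Lemma slant_dim_neq0 (x : NT) : b != 0%N.
Proof.
apply/eqP => b0; have [_ nholo _] := wss_slant semi_slant x.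
apply: nholo => y i2 j _; apply/andP; split; apply/row_subP => k; exfalso.
  by move: k; rewrite b0 => -[].
by move: k; rewrite b0 => -[].
Qed.

End WarpedSemiSlant.

Theorem theorem4p1 (R : realType) (m a beta : nat)
    (Mbar : manifold R m) (J g : tensor2 Mbar)
    (NT : manifold R a) (Nth : manifold R (2 * beta))
    (gT : tensor2 NT) (gth : tensor2 Nth) (f : NT -> R)
    (phi : prod_charted NT Nth -> Mbar) (theta : R)
    (nearly_kaehler : is_nearly_kaehler J g)
    (semi_slant : is_warped_semi_slant J g gT gth f phi theta) :
  let lnf := (fun p : prod_charted NT Nth => ln (f p.1)) in
  let bound := (fun p i j =>
    4 * beta%:R * (sin theta ^- 2 + 9^-1 * (cos theta / sin theta) ^+ 2) *
    grad_sqnorm_at g phi lnf p i j) in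
  (forall p i j, charts_at phi p i j ->
     sff_sqnorm_at g phi p i j >= bound p i j) /\
  ((forall p i j, charts_at phi p i j ->
      sff_sqnorm_at g phi p i j = bound p i j) ->
   [/\ forall y : Nth, is_totally_geodesic (leaf1 phi y) g,
       forall x : NT, is_totally_umbilical (leaf2 phi x) g
     & is_minimal phi g]).
Proof.
move=> lnf bound.
(* The factor 4 beta is twice the dimension of the second factor. *)
have boundE p i j : bound p i j = 2 * ((2 * beta)%:R * ((sin theta ^+ 2)^-1 +
    9^-1 * (cos theta ^+ 2 / sin theta ^+ 2))) * grad_sqnorm_at g phi lnf p i j.
  by rewrite /bound expr_div_n natrM; ring.
split=> [p i j pij|eq_h].
  rewrite boundE; apply: (sff_sqnorm_at_ge nearly_kaehler semi_slant) => //.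
  exact: (sin_slant_neq0 nearly_kaehler semi_slant p.1).
have {}eq_h p i j : charts_at phi p i j -> sff_sqnorm_at g phi p i j = 2 * ((2 * beta)%:R *
    ((sin theta ^+ 2)^-1 + 9^-1 * (cos theta ^+ 2 / sin theta ^+ 2))) *
    grad_sqnorm_at g phi lnf p i j.
  by move=> /eq_h ->; exact: boundE.
have sin0 := sin_slant_neq0 nearly_kaehler semi_slant.
split=> [y x i1 j [dx dj] v w|x y i2 j [dy dj] v w|p i j pij].
(* A chart of the leaf is completed to a product chart by any chart around the fixed point of the
   other factor. *)
- have [i2 dy] := dom_cover (manifoldP Nth) y.
  have xy : charts_at phi (x, y) (i1, i2) j by split.
  exact: (sff_leaf1_eq0 nearly_kaehler semi_slant (sin0 x) xy (eq_h _ _ _ xy)).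
- have [i1 dx] := dom_cover (manifoldP NT) x.
  have xy : charts_at phi (x, y) (i1, i2) j by split.
  exact: (sff_leaf2_umbilical nearly_kaehler semi_slant (sin0 x) xy (eq_h _ _ _ xy)
    (slant_dim_neq0 semi_slant x)).
exact: (mean_curvature_at_eq0 nearly_kaehler semi_slant (sin0 p.1) pij (eq_h _ _ _ pij)).
Qed.
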